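(* Let $G$ be a spherical uniform disk graph with radius $r$ on $n$ vertices. It is possible to compute, in $\mathcal{O}(n\log n)$ time, a tree decomposition $\mathcal{T}$ of $G$ with $|\mathcal{T}|\le 2n$ and a layering $(V_1,V_2,\ldots)$ of $G$ witnessing layered tree-independence number $30$. In particular, $G$ has layered tree-independence number at most $30$.
   Context: All graphs are finite and simple; $\alpha$ denotes the independence number. $\mathbb{S}^2$ is the unit sphere in $\mathbb{R}^3$ centered at the origin and $d_{\mathbb{S}^2}(a,b)$ is the spherical distance, i.e. the angle between the vectors $a,b\in\mathbb{S}^2$. For $0<r<\pi$ and $v\in\mathbb{S}^2$, the spherical disk of radius $r$ centered at $v$ is $\{u\in\mathbb{S}^2: d_{\mathbb{S}^2}(u,v)\le r\}$. A spherical uniform disk graph with radius $r$ is the intersection graph of a finite collection of spherical disks of the same radius $r$ (vertices are the disks, two distinct ones adjacent iff they intersect). For the algorithmic part, $G$ is given together with a geometric realization consisting of the polar coordinates of the disk centers: with respect to a pole $o\in\mathbb{S}^2$, its antipode $o^*$ and a polar axis (a length-$\pi$ geodesic arc from $o$ to $o^*$), a point $p\ne o,o^*$ is identified with $(b(p),\theta(p))$, where $b(p)=d_{\mathbb{S}^2}(p,o)$ and $\theta(p)\in[0,2\pi)$ is the angle from the polar axis to the geodesic segment $op$. It is assumed that for a disk $O$, computing $\inf_{x\in O}\theta(x)$ and $\sup_{x\in O}\theta(x)$ takes constant time. A tree decomposition of $G$ is a pair $\mathcal{T}=(T,\{X_t\}_{t\in V(T)})$ with $T$ a tree and bags $X_t\subseteq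 V(G)$ such that every vertex is in some bag, both endpoints of every edge lie in a common bag, and for each $u\in V(G)$ the nodes $t$ with $u\in X_t$ induce a connected subgraph of $T$; $|\mathcal{T}|=|V(T)|$. A layering of $G$ is an ordered partition $(V_1,V_2,\ldots)$ of $V(G)$ (parts may be empty, all but finitely many are) such that for each edge $uv$ with $u\in V_i$, $v\in V_j$ we have $|i-j|\le 1$. They witness layered tree-independence number $\ell$ if $\alpha(G[X_t\cap V_i])\le\ell$ for every bag $X_t$ and layer $V_i$. The layered tree-independence number of $G$ is the minimum $\ell$ witnessed by some tree decomposition and layering of $G$. *)

(* Defs.v *)
From HB Require Import structures.
From mathcomp Require Import all_boot all_order all_algebra.
From mathcomp Require Import all_classical all_reals all_analysis.

Set Implicit Arguments.
Unset Strict Implicit.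
Unset Printing Implicit Defensive.

Import Order.TTheory GRing.Theory Num.Theory.

(** * Graphs, tree decompositions, layerings *)

Section Graphs.
Local Open Scope nat_scope.

Definition simple_graph (V : finType) (e : rel V) : Prop :=
  symmetric e /\ irreflexive e.

Definition independent (V : finType) (e : rel V) (I : {set V}) : bool :=
  [forall x in I, forall y in I, ~~ e x y].

(** [alpha e S] is the independence number of the subgraph induced by [S]. *)
Definition alpha (V : finType) (e : rel V) (S : {set V}) : nat :=
  \max_(I : {set V} | (I \subset S) && independent e I) #|I|.

(** For a symmetric relation an edge is already a [ucycle] of size 2, so the
    cycles of the graph are the [ucycle]s of size at least 3. *)
Definition is_tree (T : finType) (t : rel T) : Prop :=
  [/\ simple_graph t, 0 < #|T|,
      forall a b : T, connect t a b
    & forall p : seq T, ucycle t p -> size p < 3].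

Record tree_decomposition (V : finType) (e : rel V)
    (T : finType) (t : rel T) (X : T -> {set V}) : Prop := TreeDecomposition {
  td_tree : is_tree t;
  td_vertex : forall u : V, exists a : T, u \in X a;
  td_edge : forall u v : V, e u v -> exists a : T, u \in X a /\ v \in X a;
  td_connected : forall (u : V) (a b : T), u \in X a -> u \in X b ->
    connect [rel x y | [&& t x y, u \in X x & u \in X y]] a b
}.

(** An ordered partition (V_0, V_1, ..) with possibly empty parts is given by
    the function [L] sending each vertex to the index of its part. *)
Definition layering (V : finType) (e : rel V) (L : V -> nat) : Prop :=
  forall u v : V, e u v -> L u <= (L v).+1 /\ L v <= (L u).+1.

Definition layer (V : finType) (L : V -> nat) (i : nat) : {set V} :=
  finset (fun u => L u == i).

Definition witness (V : finType) (e : rel V) (T : finType)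
    (X : T -> {set V}) (L : V -> nat) (l : nat) : Prop :=
  forall (a : T) (i : nat), alpha e (X a :&: layer L i) <= l.

Definition has_layered_witness (V : finType) (e : rel V) (l : nat) : Prop :=
  exists (T : finType) (t : rel T) (X : T -> {set V}) (L : V -> nat),
    [/\ tree_decomposition e t X, layering e L & witness e X L l].

Lemma has_layered_witness_ex (V : finType) (e : rel V) :
  exists l, `[< has_layered_witness e l >].
Proof.
exists #|V|; apply/asboolP.
exists unit, (fun _ _ => false), (fun _ => finset.setT), (fun _ => 0); split.
- split.
  + split; first by split.
    * by rewrite card_unit.
    * by move=> [] []; exact: connect0.
    * by move=> [|? [|? [|? ?]]] //; rewrite /ucycle /= ?andbF.
  + by move=> u; exists tt; rewrite finset.in_setT.
  + by move=> u v _; exists tt; rewrite !finset.in_setT.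
  + by move=> u [] [] _ _; exact: connect0.
- by move=> u v _.
- by move=> a i; apply/bigmax_leqP => I _; exact: max_card.
Qed.

Definition layered_tree_independence_number (V : finType) (e : rel V) : nat :=
  ex_minn (has_layered_witness_ex e).

End Graphs.

(** * Spherical disks and polar coordinates *)

Section Sphere.
Context {R : realType}.
Local Open Scope ring_scope.
Local Open Scope classical_set_scope.

Definition dot (u v : 'rV[R]_3) : R := \sum_i u 0 i * v 0 i.

Definition sphere : set 'rV[R]_3 := [set u | dot u u = 1].

Definition sdist (u v : 'rV[R]_3) : R := acos (dot u v).

Definition sdisk (r : R) (v : 'rV[R]_3) : set 'rV[R]_3 :=
  [set u | sphere u /\ sdist u v <= r].

(** The collection of disks is an indexed family of centers; the vertices are
    the indices. *)
Definition sdisk_graph (V : finType) (r : R) (c : V -> 'rV[R]_3) : rel V :=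
  fun i j => (i != j) && `[< sdisk r (c i) `&` sdisk r (c j) !=set0 >].

(** The polar axis is the geodesic arc of the points
    cos s *: pole + sin s *: axis_dir, 0 <= s <= pi, from the pole to its
    antipode - pole; [turn_dir] fixes the orientation in which angles at the
    pole are measured. *)
Record polar_frame := PolarFrame {
  pole : 'rV[R]_3;
  axis_dir : 'rV[R]_3;
  turn_dir : 'rV[R]_3;
  polar_frame_unit :
    [/\ sphere pole, sphere axis_dir & sphere turn_dir];
  polar_frame_orthogonal :
    [/\ dot pole axis_dir = 0, dot pole turn_dir = 0
      & dot axis_dir turn_dir = 0]
}.

(** For p = [pole] or p = - [pole], sin b = 0 and every theta in [0, 2 pi[ is
    accepted. *)
Definition polar_coord (F : polar_frame) (p : 'rV[R]_3) (b theta : R) : Prop :=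
  [/\ b = sdist p (pole F), 0 <= theta < 2 * pi
    & p = cos b *: pole F
          + sin b *: (cos theta *: axis_dir F + sin theta *: turn_dir F)].

(** The values theta(x) for x in [O]; theta is only defined off the poles. *)
Definition angles (F : polar_frame) (O : set 'rV[R]_3) : set R :=
  [set theta | exists x, [/\ O x, x != pole F, x != - pole F
                           & polar_coord F x (sdist x (pole F)) theta]].

Definition inf_angle (F : polar_frame) (O : set 'rV[R]_3) : R :=
  inf (angles F O).
Definition sup_angle (F : polar_frame) (O : set 'rV[R]_3) : R :=
  sup (angles F O).

End Sphere.
Arguments polar_frame : clear implicits.

(** * A real RAM

    Programs are finite syntactic objects that do not depend on the input. The
    memory consists of integer arrays and real arrays, both indexed by a
    constant array name and a computed address; a scalar variable is an array
    used at address 0 only. Integers support addition and truncated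
    subtraction; reals support the field operations and comparisons. Reals
    cannot be converted to integers (no rounding). In addition, [InfAngle e]
    and [SupAngle e] return the smallest and largest angle of the input disk
    with index [e]. *)

Inductive iexp : Type :=
| IConst of nat
| ILoad of nat & iexp
| IAdd of iexp & iexp
| ISub of iexp & iexp.

Inductive rexp : Type :=
| RZero
| ROne
| RLoad of nat & iexp
| RAdd of rexp & rexp
| RSub of rexp & rexp
| RMul of rexp & rexp
| RDiv of rexp & rexp
| InfAngle of iexp
| SupAngle of iexp.

Inductive bexp : Type :=
| ILe of iexp & iexp
| RLe of rexp & rexp
| BNot of bexp
| BAnd of bexp & bexp.

Inductive cmd : Type :=
| Skip
| IStore of nat & iexp & iexp
| RStore of nat & iexp & rexp
| Seq of cmd & cmd
| If of bexp & cmd & cmd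
| While of bexp & cmd.

Section RealRAM.
Context {R : realType}.
Local Open Scope ring_scope.

Record store := Store {
  ints : nat -> nat -> nat;
  reals : nat -> nat -> R
}.

Definition upd (A : Type) (m : nat -> nat -> A) (a i : nat) (x : A) :
    nat -> nat -> A :=
  fun a' i' => if (a' == a) && (i' == i) then x else m a' i'.

Variables inf_oracle sup_oracle : nat -> R.

Fixpoint ieval (s : store) (e : iexp) : nat :=
  match e with
  | IConst k => k
  | ILoad a i => ints s a (ieval s i)
  | IAdd e1 e2 => (ieval s e1 + ieval s e2)%N
  | ISub e1 e2 => (ieval s e1 - ieval s e2)%N
  end.

Fixpoint reval (s : store) (e : rexp) : R :=
  match e with
  | RZero => 0
  | ROne => 1
  | RLoad a i => reals s a (ieval s i)
  | RAdd e1 e2 => reval s e1 + reval s e2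
  | RSub e1 e2 => reval s e1 - reval s e2
  | RMul e1 e2 => reval s e1 * reval s e2
  | RDiv e1 e2 => reval s e1 / reval s e2
  | InfAngle i => inf_oracle (ieval s i)
  | SupAngle i => sup_oracle (ieval s i)
  end.

Fixpoint beval (s : store) (e : bexp) : bool :=
  match e with
  | ILe e1 e2 => (ieval s e1 <= ieval s e2)%N
  | RLe e1 e2 => reval s e1 <= reval s e2
  | BNot e1 => ~~ beval s e1
  | BAnd e1 e2 => beval s e1 && beval s e2
  end.

(** [exec c s t s']: started in [s], [c] halts in [s'] after [t] steps. Each
    [Skip], store and test is one step: the expressions in a fixed program have
    bounded size. *)
Inductive exec : cmd -> store -> nat -> store -> Prop :=
| exec_skip s : exec Skip s 1 s
| exec_istore s a i e :
    exec (IStore a i e) s 1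
      (Store (upd (ints s) a (ieval s i) (ieval s e)) (reals s))
| exec_rstore s a i e :
    exec (RStore a i e) s 1
      (Store (ints s) (upd (reals s) a (ieval s i) (reval s e)))
| exec_seq c1 c2 s1 s2 s3 t1 t2 :
    exec c1 s1 t1 s2 -> exec c2 s2 t2 s3 ->
    exec (Seq c1 c2) s1 (t1 + t2)%N s3
| exec_if b c1 c2 s s' t :
    exec (if beval s b then c1 else c2) s t s' ->
    exec (If b c1 c2) s t.+1 s'
| exec_while_false b c s : ~~ beval s b -> exec (While b c) s 1 s
| exec_while_true b c s1 s2 s3 t1 t2 :
    beval s1 b -> exec c s1 t1 s2 -> exec (While b c) s2 t2 s3 ->
    exec (While b c) s1 (t1 + t2).+1 s3.

End RealRAM.
Arguments store : clear implicits.

(** * Input and output formats *)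

Section InputOutput.
Context {R : realType}.

Definition extend (n : nat) (f : 'I_n -> R) (i : nat) : R :=
  if insub i is Some j then f j else 0%R.

(** Integer array 0 holds n (at address 0); real arrays 0, 1 and 2 hold the
    radius (at address 0) and the coordinates b and theta of the centers. All
    other cells are 0. *)
Definition input (n : nat) (r : R) (b theta : 'I_n -> R) : store R :=
  Store
    (fun a i => if (a == 0) && (i == 0) then n else 0)
    (fun a i => match a with
                | 0 => if i == 0 then r else 0%R
                | 1 => extend b i
                | 2 => extend theta i
                | _ => 0%R
                end).

Variable s : store R.

(** The bags of a tree decomposition can have quadratic total size, so they are
    not listed one by one. The output is a tree rooted at node 0 with, for each
    node, the list of the vertices in which its bag differs from the bag of its
    parent (for the root: from the empty set). *)
Definition out_size : nat := ints s 1 0.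
Definition out_parent (a : nat) : nat := ints s 2 a.
Definition out_offset (a : nat) : nat := ints s 3 a.
Definition out_entry (k : nat) : nat := ints s 4 k.
Definition out_layer (n : nat) (v : 'I_n) : nat := ints s 5 v.

(** Parents precede their children, and the lists of differences are
    consecutive blocks of a single array. *)
Definition out_wf : Prop :=
  (forall a, 0 < a < out_size -> out_parent a < a) /\
  (forall a, a < out_size -> out_offset a <= out_offset a.+1).

Definition out_tree : rel 'I_out_size :=
  fun a b => ((0 < a) && (out_parent a == b)) ||
             ((0 < b) && (out_parent b == a)).

Definition out_diff (n a : nat) : {set 'I_n} :=
  finset (fun v : 'I_n =>
    has (fun k => out_entry k == v)
        (index_iota (out_offset a) (out_offset a.+1))).

Definition symdiff (V : finType) (A B : {set V}) : {set V} :=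
  (A :\: B) :|: (B :\: A).

(** Under [out_wf], [a.+1] unfoldings reach the root from node [a]. *)
Fixpoint out_bag_rec (n fuel a : nat) : {set 'I_n} :=
  if fuel is k.+1 then
    symdiff (if a == 0 then finset.set0 else out_bag_rec n k (out_parent a))
            (out_diff n a)
  else finset.set0.

Definition out_bag (n : nat) (a : 'I_out_size) : {set 'I_n} :=
  out_bag_rec n a.+1 a.

End InputOutput.

(* Main.v *)
Require Import Defs.
From mathcomp Require Import all_boot all_order all_algebra ring lra zify.
From mathcomp Require Import all_classical all_reals all_analysis.

Set Implicit Arguments.
Unset Strict Implicit.
Unset Printing Implicit Defensive.

Import Order.TTheory GRing.Theory Num.Theory.

(** Sweep the sphere by half-meridians. The intervals [inf_angle, sup_angle] of
    two intersecting disks intersect, so inserting and deleting the disks in the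
    order of the 2n sorted endpoints gives a path decomposition with 2n bags.
    The layers are cut greedily along the sorted latitudes, a new one starting
    when the latitude exceeds the first latitude of the current layer by more
    than 2r: adjacent disks have latitudes differing by at most 2r, hence lie in
    equal or consecutive layers, and each layer has latitude width at most 2r.
    No rounding and no bound on 1/r is needed.

    A disk in the bag at angle phi meets the half-meridian at phi or, if it
    crosses the polar axis, the one at 0. For each of these two half-meridians
    the centers in a given layer of the disks meeting it are covered by 10 disks
    of radius r, centered at the two poles and at 4 points on either side of the
    meridian. Two disks whose centers lie in the same covering disk intersect, so
    an independent set has at most 20 elements. *)

(** * Timed program logic *)

Section ProgramLogic.
Context {R : realType}.
Variables inf_oracle sup_oracle : nat -> R.
Local Open Scope nat_scope.

Local Notation exec := (exec inf_oracle sup_oracle).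
Local Notation ieval := (@ieval R).
Local Notation reval := (reval inf_oracle sup_oracle).
Local Notation beval := (beval inf_oracle sup_oracle).

(** Loop-free commands always halt, so their effect is computed by [run] and their time is bounded
    by syntax alone. Only loops need an invariant. *)
Fixpoint loopfree (c : cmd) : bool :=
  match c with
  | Seq c1 c2 | If _ c1 c2 => loopfree c1 && loopfree c2
  | While _ _ => false
  | _ => true
  end.

Fixpoint cost (c : cmd) : nat :=
  match c with
  | Seq c1 c2 => cost c1 + cost c2
  | If _ c1 c2 => (maxn (cost c1) (cost c2)).+1
  | _ => 1
  end.

Fixpoint run (c : cmd) (s : store R) : store R :=
  match c with
  | IStore a i e => Store (upd (ints s) a (ieval s i) (ieval s e)) (reals s)
  | RStore a i e => Store (ints s) (upd (reals s) a (ieval s i) (reval s e))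
  | Seq c1 c2 => run c2 (run c1 s)
  | If b c1 c2 => if beval s b then run c1 s else run c2 s
  | _ => s
  end.

Lemma exec_run c s :
  loopfree c -> exists2 t, t <= cost c & exec c s t (run c s).
Proof.
elim: c s => [|a i e|a i e|c1 IH1 c2 IH2|b c1 IH1 c2 IH2|//] s /=.
- by move=> _; exists 1 => //; exact: exec_skip.
- by move=> _; exists 1 => //; exact: exec_istore.
- by move=> _; exists 1 => //; exact: exec_rstore.
- case/andP=> /(IH1 s)[t1 le1 ex1] /(IH2 (run c1 s))[t2 le2 ex2].
  by exists (t1 + t2); [exact: leq_add | exact: exec_seq ex1 ex2].
- case/andP=> /(IH1 s)[t1 le1 ex1] /(IH2 s)[t2 le2 ex2].
  case E: (beval s b).
  + by exists t1.+1; [rewrite ltnS leq_max le1 | apply: exec_if; rewrite E].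
  + by exists t2.+1; [rewrite ltnS leq_max le2 orbT | apply: exec_if; rewrite E].
Qed.

(** Total correctness with a time budget. Since the postcondition is an arbitrary predicate, the
    rest of a program can be put in its place, which is how [ends_seq] chains commands. *)
Definition ends (c : cmd) (s : store R) (k : nat) (Q : store R -> Prop) :=
  exists t s', [/\ exec c s t s', t <= k & Q s'].

Lemma ends_weaken c s k k' (Q Q' : store R -> Prop) :
  ends c s k Q -> k <= k' -> (forall s', Q s' -> Q' s') -> ends c s k' Q'.
Proof.
move=> [t [s' [ex le q]]] lek qq.
by exists t, s'; split; [|exact: leq_trans le lek|exact: qq].
Qed.

Lemma ends_run c s k (Q : store R -> Prop) :
  loopfree c -> cost c <= k -> Q (run c s) -> ends c s k Q.
Proof.
move=> lf lek q; have [t le ex] := exec_run s lf.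
by exists t, (run c s); split=> //; exact: leq_trans le lek.
Qed.

Lemma ends_seq c1 c2 s k1 k2 Q :
  ends c1 s k1 (fun s' => ends c2 s' k2 Q) -> ends (Seq c1 c2) s (k1 + k2) Q.
Proof.
move=> [t1 [s1 [ex1 le1 [t2 [s2 [ex2 le2 q]]]]]].
by exists (t1 + t2), s2; split; [exact: exec_seq ex1 ex2|exact: leq_add|].
Qed.

Fixpoint int_writes (c : cmd) : seq nat :=
  match c with
  | IStore a _ _ => [:: a]
  | Seq c1 c2 | If _ c1 c2 => int_writes c1 ++ int_writes c2
  | While _ c1 => int_writes c1
  | _ => [::]
  end.

Fixpoint real_writes (c : cmd) : seq nat :=
  match c with
  | RStore a _ _ => [:: a]
  | Seq c1 c2 | If _ c1 c2 => real_writes c1 ++ real_writes c2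
  | While _ c1 => real_writes c1
  | _ => [::]
  end.

(** Purely syntactic, so invariants need to mention only the arrays that a loop body writes. *)
Definition frame (c : cmd) (s s' : store R) :=
  (forall a, a \notin int_writes c -> ints s' a = ints s a) /\
  (forall a, a \notin real_writes c -> reals s' a = reals s a).

Lemma frame_refl c s : frame c s s.
Proof. by []. Qed.

Lemma frame_trans c s1 s2 s3 : frame c s1 s2 -> frame c s2 s3 -> frame c s1 s3.
Proof.
move=> [i1 r1] [i2 r2]; split=> a ha; first by rewrite i2 // i1.
by rewrite r2 // r1.
Qed.

Lemma exec_frame c s t s' : exec c s t s' -> frame c s s'.
Proof.
elim=> {c s t s'} //=.
- by move=> s a i e; split=> //= a'; rewrite inE /upd => /negbTE ->.
- by move=> s a i e; split=> //= a'; rewrite inE /upd => /negbTE ->.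
- move=> c1 c2 s1 s2 s3 _ _ _ [i1 r1] _ [i2 r2]; split=> a /=;
    rewrite mem_cat negb_or => /andP[h1 h2].
    by rewrite i2 // i1.
  by rewrite r2 // r1.
- move=> b c1 c2 s s' t _; case: (beval s b) => [] [i1 r1]; split=> a /=;
    rewrite mem_cat negb_or => /andP[h1 h2]; by [exact: i1|exact: r1].
- move=> b c s1 s2 s3 _ _ _ _ [i1 r1] _ [i2 r2]; split=> a /= h.
    by rewrite i2 // i1.
  by rewrite r2 // r1.
Qed.

Lemma ends_frame c s k Q : ends c s k Q -> ends c s k (fun s' => Q s' /\ frame c s s').
Proof.
by move=> [t [s' [ex le q]]]; exists t, s'; do 2?split=> //; exact: exec_frame ex.
Qed.

(** The number [N] of iterations is fixed in advance; each costs one test plus at most [k] steps,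
    and the last unit is the failing test. *)
Lemma ends_loop b c N k (I : nat -> store R -> Prop) s :
    I 0 s ->
    (forall j s', j <= N -> I j s' -> frame c s s' -> beval s' b = (j < N)) ->
    (forall j s', j < N -> I j s' -> frame c s s' -> ends c s' k (I j.+1)) ->
  ends (While b c) s (N * k.+1).+1 (I N).
Proof.
move=> I0 guard body.
suff loop d j s' : d + j = N -> I j s' -> frame c s s' ->
    ends (While b c) s' (d * k.+1).+1 (I N).
  exact: (loop N 0 s (addn0 N) I0 (frame_refl c s)).
elim: d j s' => [|d IH] j s' jN Ij fr.
  have g := guard j s' _ Ij fr; rewrite -jN in g *; rewrite add0n leqnn ltnn in g.
  by exists 1, s'; split=> //; apply: exec_while_false; rewrite g.
have lt_jN : j < N by rewrite -jN addSn ltnS leq_addl.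
have /ends_frame[t1 [s1 [ex1 le1 [I1 fr1]]]] := body j s' lt_jN Ij fr.
have [||t2 [s2 [ex2 le2 I2]]] := IH j.+1 s1 _ I1; first by rewrite addnS -addSn.
  exact: frame_trans fr fr1.
exists (t1 + t2).+1, s2; split=> //.
  by apply: exec_while_true ex1 ex2; rewrite (guard j) // ltnW.
by rewrite mulSn; move: (d * k.+1) le2 => q le2; lia.
Qed.

End ProgramLogic.

(** * Passes of bottom-up merge sort on lists *)

Section MergePass.
Context (T : Type) (leT : rel T) (w : nat).
Local Open Scope nat_scope.

(** The recursion removes [w + w] elements at a time, which is not structural; a relation avoids a
    termination argument. Applied to the empty list, the second rule adds nothing. *)
Inductive merge_pass : seq T -> seq T -> Prop :=
| merge_pass_nil : merge_pass [::] [::]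
| merge_pass_cons s t :
    merge_pass (drop (w + w) s) t ->
    merge_pass s (merge leT (take w s) (take w (drop w s)) ++ t).

Definition slice (s : seq T) (i j : nat) : seq T := take (j - i) (drop i s).

Lemma slice_nil s i j : j <= i -> slice s i j = [::].
Proof. by rewrite /slice -subn_eq0 => /eqP ->; rewrite take0. Qed.

Lemma slice_cons x0 s i j :
  i < j <= size s -> slice s i j = nth x0 s i :: slice s i.+1 j.
Proof.
case/andP=> ij js; rewrite /slice (drop_nth x0) ?(leq_trans ij) //.
by rewrite subnS; case: (j - i) (subn_gt0 i j) => [|d] //=; rewrite ij.
Qed.

Lemma slice_min s i : slice s i (minn (i + w) (size s)) = take w (drop i s).
Proof.
rewrite /slice; case: (leqP (i + w) (size s)) => h; first by rewrite addKn.
have hd : size (drop i s) <= w by rewrite size_drop leq_subLR ltnW.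
by rewrite !take_oversize // size_drop.
Qed.

Lemma drop_min (s : seq T) i : drop (minn i (size s)) s = drop i s.
Proof.
by case: (leqP i (size s)) => // h; rewrite drop_size drop_oversize // ltnW.
Qed.

End MergePass.

Section MergePassSorts.
Context (T : eqType) (leT : rel T) (leT_total : total leT).
Local Open Scope nat_scope.

(** The last block may be short and blocks past the end are empty, so nothing has to relate [w] to
    the length. *)
Definition blocks_sorted (w : nat) (s : seq T) : Prop :=
  forall l, sorted leT (take w (drop (l * w) s)).

Lemma merge_pass_perm w s t : merge_pass leT w s t -> perm_eq t s.
Proof.
elim=> {s t} // s t _ IH; rewrite perm_sym.
rewrite -[X in perm_eq X](cat_take_drop w s) -[X in _ ++ X](cat_take_drop w (drop w s)).
rewrite drop_drop.
by rewrite catA perm_sym perm_cat // perm_merge.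
Qed.

(** The merge of the first two blocks has length [w + w] unless the list ends there, so block
    boundaries of the output fall on multiples of [w + w]. *)
Lemma merge_pass_blocks w s t :
  merge_pass leT w s t -> blocks_sorted w s -> blocks_sorted (w + w) t.
Proof.
elim=> {s t} // s t st IH bs.
have {}IH : blocks_sorted (w + w) t.
  by apply: IH => l; have := bs (l + 2); rewrite mulnDl drop_drop mul2n addnn.
have srt : sorted leT (merge leT (take w s) (take w (drop w s))).
  apply: merge_sorted => //; last by have := bs 1; rewrite mul1n.
  by have := bs 0; rewrite mul0n drop0.
have pt := perm_size (merge_pass_perm st); rewrite size_drop in pt.
set u := merge _ _ _ in srt *.
have su : size u = minn (w + w) (size s).
  by rewrite /u size_merge -takeD size_take_min.
move=> l; case: (leqP (w + w) (size s)) => h.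
  have eu : size u = w + w by rewrite su; apply/minn_idPl.
  case: l => [|l]; first by rewrite mul0n drop0 -eu take_size_cat.
  by rewrite mulSn addnC -drop_drop -[in drop (w + w) _]eu drop_size_cat.
have et : t = [::] by apply: size0nil; apply/eqP; rewrite pt subn_eq0 ltnW.
rewrite et cats0; case: l => [|l].
  by rewrite mul0n drop0 take_oversize // su geq_minl.
rewrite drop_oversize // su mulSn; apply: leq_trans (geq_minl _ _) (leq_addr _ _).
Qed.

End MergePassSorts.

(** * Merge sort *)

Definition var (x : nat) : iexp := ILoad x (IConst 0).
Definition set_var (x : nat) (e : iexp) : cmd := IStore x (IConst 0) e.
Definition incr (x : nat) : cmd := set_var x (IAdd (var x) (IConst 1)).
Definition ilt (e1 e2 : iexp) : bexp := BNot (ILe e2 e1).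
Definition bor (b1 b2 : bexp) : bexp := BNot (BAnd (BNot b1) (BNot b2)).
(** This is a minimum because subtraction is truncated. *)
Definition imin (e1 e2 : iexp) : iexp := ISub e1 (ISub e1 e2).

(** Program counterpart of [lex], literally of the same shape so that evaluating it gives [lex]. *)
Definition lex_key (ka : nat) (x y : iexp) : bexp :=
  BAnd (RLe (RLoad ka x) (RLoad ka y))
       (BNot (BAnd (RLe (RLoad ka y) (RLoad ka x)) (BNot (ILe x y)))).

Section SortProgram.
Local Open Scope nat_scope.
Variable ka : nat.

(* Integer arrays: 6 holds the current permutation and 7 the merged blocks;
   the scalars are 8 = length, 9 = block width, 10 = next output position, and
   the remaining parts of the two blocks being merged are from 11 to 12 and from
   13 to 14. *)
Definition next_blocks : cmd :=
  If (ILe (var 14) (var 10))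
     (Seq (set_var 11 (var 14))
     (Seq (set_var 12 (imin (IAdd (var 14) (var 9)) (var 8)))
     (Seq (set_var 13 (var 12))
          (set_var 14 (imin (IAdd (var 12) (var 9)) (var 8))))))
     Skip.

Definition merge_step : cmd :=
  Seq (If (BAnd (ilt (var 11) (var 12))
             (bor (ILe (var 14) (var 13))
                  (lex_key ka (ILoad 6 (var 11)) (ILoad 6 (var 13)))))
          (Seq (IStore 7 (var 10) (ILoad 6 (var 11))) (incr 11))
          (Seq (IStore 7 (var 10) (ILoad 6 (var 13))) (incr 13)))
      (incr 10).

(** Each iteration outputs exactly one element and fetches new blocks on demand; without nested
    loops, a pass is visibly linear. *)
Definition merge_loop : cmd :=
  While (ilt (var 10) (var 8)) (Seq next_blocks merge_step).

Definition merge_init : cmd :=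
  Seq (set_var 10 (IConst 0)) (Seq (set_var 11 (IConst 0))
  (Seq (set_var 12 (IConst 0)) (Seq (set_var 13 (IConst 0))
       (set_var 14 (IConst 0))))).

Definition copy_loop : cmd :=
  While (ilt (var 10) (var 8))
        (Seq (IStore 6 (var 10) (ILoad 7 (var 10))) (incr 10)).

Definition fill_loop : cmd :=
  While (ilt (var 10) (var 8)) (Seq (IStore 6 (var 10) (var 10)) (incr 10)).

Definition width_step : cmd :=
  Seq merge_init (Seq merge_loop
  (Seq (set_var 10 (IConst 0)) (Seq copy_loop
       (set_var 9 (IAdd (var 9) (var 9)))))).

Definition sort_prog : cmd :=
  Seq (Seq (set_var 10 (IConst 0)) (Seq fill_loop (set_var 9 (IConst 1))))
      (While (ilt (var 9) (var 8)) width_step).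

End SortProgram.

(** * Correctness and running time of merge sort *)

Section SortCorrect.
Context {R : realType}.
Variables inf_oracle sup_oracle : nat -> R.
Local Open Scope nat_scope.
Local Notation ends := (ends inf_oracle sup_oracle).
Local Notation run := (run inf_oracle sup_oracle).

(* The interval of v has endpoints v and v + n, so breaking ties by index places
   insertions before deletions, as closed intervals require. *)
Definition lex (key : nat -> R) : rel nat := fun x y =>
  (key x <= key y)%R && ~~ ((key y <= key x)%R && ~~ (x <= y)).

Lemma lexE key x y : lex key x y = (key x < key y)%R || (key x == key y) && (x <= y).
Proof. by rewrite /lex; case: (ltgtP (key x) (key y)); rewrite ?negbK. Qed.

Lemma lex_total key : total (lex key).
Proof. by move=> x y; rewrite !lexE; case: ltgtP => //= _; exact: leq_total. Qed.

Lemma lex_trans key : transitive (lex key).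
Proof.
move=> y x z; rewrite !lexE.
case: (ltgtP (key x) (key y)) => [xy _|//|xy /= le1].
  case: (ltgtP (key y) (key z)) => [yz _|//|yz _]; last by rewrite -yz xy.
  by rewrite (lt_trans xy yz).
rewrite xy; case: ltgtP => //= _ le2; exact: leq_trans le1 le2.
Qed.

Lemma lex_refl key : reflexive (lex key).
Proof. by move=> x; rewrite lexE eqxx leqnn orbT. Qed.

Lemma lex_anti key : antisymmetric (lex key).
Proof.
move=> x y; rewrite !lexE; case: ltgtP => //= _; exact: anti_leq.
Qed.

Lemma mkseq_upd_last (f : nat -> nat) k x :
  mkseq (fun i => if i == k then x else f i) k.+1 = rcons (mkseq f k) x.
Proof.
rewrite mkseqS eqxx; congr rcons; rewrite /mkseq.
by apply/eq_in_map => i; rewrite mem_iota /= => /ltn_eqF ->.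
Qed.

Section MergeLoop.
Variables (ka m w : nat) (s0 : store R).
Let a := mkseq (ints s0 6) m.
Let le := lex (reals s0 ka).

Definition same_input (s : store R) : Prop :=
  [/\ ints s 6 = ints s0 6, ints s 8 0 = m, ints s 9 0 = w
    & reals s = reals s0].

(** The counting equation says that the written prefix and the rest of both blocks fill the
    positions below [hi]. The last clause is a promise: any pass over the untouched suffix completes
    the present state to a pass over the whole list. *)
Definition merge_inv (k : nat) (s : store R) : Prop :=
  let i := ints s 11 0 in let mid := ints s 12 0 in
  let j := ints s 13 0 in let hi := ints s 14 0 in
  [/\ same_input s, ints s 10 0 = k, [&& i <= mid, mid <= m, j <= hi & hi <= m],
      k + (mid - i) + (hi - j) = hi
    & forall t, merge_pass le w (drop hi a) t ->
        merge_pass le w a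
          (mkseq (ints s 7) k ++ merge le (slice a i mid) (slice a j hi) ++ t)].

(** Once [k] reaches [hi], the counting equation forces both blocks to be exhausted, and the next
    two start at [hi], cut off at the end of the list. *)
Lemma next_blocksP k s : 0 < w -> k < m -> merge_inv k s ->
  merge_inv k (run next_blocks s) /\ k < ints (run next_blocks s) 14 0.
Proof.
move=> w0 km [[e6 e8 e9 er] ek /and4P[le1 le2 le3 le4] sz fin].
have sa : size a = m by rewrite size_mkseq.
rewrite /= ek; case: (leqP (ints s 14 0) k) => hk; last first.
  by do 2?split=> //; apply/and4P.
rewrite /= /upd /= e8 e9 -!minnE.
have hi_k : ints s 14 0 = k by lia.
have im : ints s 12 0 <= ints s 11 0 by lia.
have jh : ints s 14 0 <= ints s 13 0 by lia.
rewrite hi_k; split; last by lia.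
split=> //=; [by apply/and4P; split; lia | lia |].
have E1 : drop (minn (k + w) (size a)) a = drop w (drop k a).
  by rewrite drop_min drop_drop addnC.
have E2 : drop (minn (minn (k + w) (size a) + w) (size a)) a
          = drop (w + w) (drop k a).
  by rewrite drop_min addnC -drop_drop E1 drop_drop.
move=> t; rewrite -sa E2 !slice_min E1 => st.
rewrite hi_k in fin; rewrite !slice_nil // in fin; last by rewrite -hi_k.
by apply: fin; exact: merge_pass_cons.
Qed.

(** The element written is the head of the [merge] of the two remaining slices, so it merely moves
    from that merge to the written prefix. *)
Lemma merge_stepP k s : k < m -> merge_inv k s -> k < ints s 14 0 ->
  merge_inv k.+1 (run (merge_step ka) s).
Proof.
move=> km [[e6 e8 e9 er] ek /and4P[le1 le2 le3 le4] sz fin] khi.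
have sa : size a = m by rewrite size_mkseq.
have nth_a i : i < m -> nth 0 a i = ints s0 6 i by exact: nth_mkseq.
rewrite /= -ltnNge negb_and !negbK e6 er.
set i := ints s 11 0 in le1 sz fin *; set mid := ints s 12 0 in le1 le2 sz fin *.
set j := ints s 13 0 in le3 sz fin *; set hi := ints s 14 0 in khi le3 le4 sz fin *.
case: (ltnP i mid) => im /=.
  case: (leqP hi j) => hj /=.
    move Ek1 : k.+1 => k1; rewrite /merge_inv /= /upd /= ek !addn1; split=> //.
    - by apply/and4P; split.
    - by rewrite -/mid -/hi -/j; lia.
    move=> t st; rewrite -Ek1 mkseq_upd_last cat_rcons -/mid -/hi -/j -/i.
    have := fin t st; rewrite (@slice_cons _ 0 a i) ?im ?sa //.
    rewrite [slice a j hi]slice_nil // nth_a ?(leq_trans im) //=.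
    by case: (slice a i.+1 mid).
  rewrite -[X in if X then _ else _]/(le (ints s0 6 i) (ints s0 6 j)).
  case E : (le _ _).
    move Ek1 : k.+1 => k1; rewrite /merge_inv /= /upd /= ek !addn1; split=> //.
    - by apply/and4P; split.
    - by rewrite -/mid -/hi -/j; lia.
    move=> t st; rewrite -Ek1 mkseq_upd_last cat_rcons -/mid -/hi -/j -/i.
    have := fin t st; rewrite (@slice_cons _ 0 a i) ?im ?sa //.
    rewrite (@slice_cons _ 0 a j) ?hj ?sa //.
    by rewrite !nth_a ?(leq_trans im) ?(leq_trans hj) //= E.
  move Ek1 : k.+1 => k1; rewrite /merge_inv /= /upd /= ek !addn1; split=> //.
  - by apply/and4P; split.
  - by rewrite -/mid -/hi -/i; lia.
  move=> t st; rewrite -Ek1 mkseq_upd_last cat_rcons -/mid -/hi -/j -/i.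
  have := fin t st; rewrite (@slice_cons _ 0 a i) ?im ?sa //.
  rewrite (@slice_cons _ 0 a j) ?hj ?sa //.
  by rewrite !nth_a ?(leq_trans im) ?(leq_trans hj) //= E.
have hj : j < hi by lia.
move Ek1 : k.+1 => k1; rewrite /merge_inv /= /upd /= ek !addn1; split=> //.
- by apply/and4P; split.
- by rewrite -/mid -/hi -/i; lia.
move=> t st; rewrite -Ek1 mkseq_upd_last cat_rcons -/mid -/hi -/j -/i.
have := fin t st; rewrite [slice a i mid]slice_nil //.
by rewrite (@slice_cons _ 0 a j) ?hj ?sa // nth_a ?(leq_trans hj).
Qed.

Lemma merge_loopP : 0 < w -> merge_inv 0 s0 ->
  ends (merge_loop ka) s0 (m * 13).+1 (fun s =>
    [/\ merge_pass le w a (mkseq (ints s 7) m), ints s 8 0 = m, ints s 9 0 = w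
      & reals s = reals s0]).
Proof.
move=> w0 inv0; apply: (@ends_weaken _ _ _ _ _ _ _ (merge_inv m)).
- apply: (@ends_loop _ _ _ _ _ m 12 merge_inv) => //.
  + by move=> k s' _ [[_ e8 _ _] ek _ _ _] _; rewrite /= ek e8 -ltnNge.
  + move=> k s' km inv _; apply: ends_run => //.
    rewrite -[run _ _]/(run (merge_step ka) (run next_blocks s')).
    by have [inv' khi] := next_blocksP w0 km inv; exact: merge_stepP.
- by [].
- move=> s' [[e6 e8 e9 er] ek /and4P[le1 le2 le3 le4] sz fin]; split=> //.
  (* At [k = m] the counting equation gives [hi = m] and two empty slices, so the outstanding pass
     is over the empty list. *)
  have /fin : merge_pass le w (drop (ints s' 14 0) a) [::].
    rewrite drop_oversize ?size_mkseq; last by lia.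
    exact: merge_pass_nil.
  by rewrite !slice_nil ?cats0 //; lia.
Qed.

End MergeLoop.

Definition sort_state (key : nat -> R) (m w : nat) (s : store R) : Prop :=
  let a := mkseq (ints s 6) m in
  [/\ ints s 8 0 = m, ints s 9 0 = w, perm_eq a (iota 0 m)
    & blocks_sorted (lex key) w a].

Lemma width_stepP ka m w s : 0 < w ->
  sort_state (reals s ka) m w s ->
  ends (width_step ka) s (m * 16 + 9) (sort_state (reals s ka) m (w + w)).
Proof.
move=> w0 [e8 e9 pa ba].
set a := mkseq (ints s 6) m in pa ba.
apply: (@ends_weaken _ _ _ _ _ (5 + ((m * 13).+1 + (1 + ((m * 3).+1 + 1))))
  _ _ _ _ _ (fun _ h => h)); last by lia.
apply: ends_seq; apply: ends_run => //=; rewrite /upd /=.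
set s1 := Store _ _.
have inv0 : merge_inv ka m w s1 0 s1.
  by split=> // t; rewrite !slice_nil // drop0.
apply: ends_seq.
apply: (ends_weaken (ends_frame (merge_loopP w0 inv0)) (leqnn _)) => s2.
case=> [[mp e8' e9' er'] [fi _]].
apply: ends_seq; apply: ends_run => //=; rewrite /upd /=.
set s3 := Store _ _.
apply: ends_seq.
apply: (@ends_weaken _ _ _ _ _ (m * 3).+1 _ (fun s' =>
    (forall p, p < m -> ints s' 6 p = ints s2 7 p)
      /\ frame copy_loop s3 s')) => //.
  apply: ends_frame.
  apply: (@ends_weaken _ _ _ _ _ (m * 3).+1 _ (fun s' =>
      ints s' 10 0 = m /\ forall p, p < m -> ints s' 6 p = ints s2 7 p)) => //;
    last by move=> ? [].
  apply: (@ends_loop _ _ _ _ _ m 2 (fun k s' =>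
    ints s' 10 0 = k /\ forall p, p < k -> ints s' 6 p = ints s2 7 p)) => //.
    move=> k s' _ [ek _] [fi' _].
    by rewrite /= ek fi' // -ltnNge [ints s3 8 0]e8'.
  move=> k s' km [ek eq6] [fi' _]; apply: ends_run => //=; rewrite /upd /= ek addn1.
  split=> // p; rewrite ltnS leq_eqVlt fi' //=.
  by case: eqP => [->|] //= _ pk; exact: eq6.
move=> s4 [e6 [fi4 _]].
apply: ends_run => //.
have ea : mkseq (ints s4 6) m = mkseq (ints s2 7) m.
  by apply/eq_in_map => p; rewrite mem_iota => /andP[_]; exact: e6.
have ea1 : mkseq (ints s1 6) m = a by [].
rewrite /sort_state /= /upd /= (fi4 8) // (fi4 9) //.
rewrite -[mkseq _ m]/(mkseq (ints s4 6) m) ea; split=> //.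
- by rewrite -[ints s3 9 0]/(ints s2 9 0) e9'.
- by rewrite (perm_trans (merge_pass_perm mp)).
- exact: merge_pass_blocks (@lex_total _) _ _ _ mp ba.
Qed.

Definition sort_cost (m : nat) : nat :=
  m * 3 + 4 + up_log 2 m * (m * 16 + 10).

(** The width after [j] rounds is [2 ^ j], and [up_log 2 m] is the least exponent for which one
    block holds the whole list. *)
Lemma sort_progP ka m s : ints s 8 0 = m ->
  ends (sort_prog ka) s (sort_cost m) (fun s' =>
    perm_eq (mkseq (ints s' 6) m) (iota 0 m) /\
    sorted (lex (reals s ka)) (mkseq (ints s' 6) m)).
Proof.
move=> e8; set N := up_log 2 m.
apply: (@ends_weaken _ _ _ _ _
  ((1 + ((m * 3).+1 + 1)) + (N * (m * 16 + 9).+1).+1)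
  _ _ _ _ _ (fun _ h => h)); last by rewrite /sort_cost -/N; lia.
apply: ends_seq; apply: (@ends_weaken _ _ _ _ _ (1 + ((m * 3).+1 + 1)) _
  (fun s' => sort_state (reals s ka) m 1 s' /\ reals s' ka = reals s ka)) => //.
  apply: ends_seq; apply: ends_run => //=; rewrite /upd /=; set s1 := Store _ _.
  apply: ends_seq; apply: (@ends_weaken _ _ _ _ _ (m * 3).+1 _ (fun s' =>
    (ints s' 10 0 = m /\ forall p, p < m -> ints s' 6 p = p)
      /\ frame fill_loop s1 s')) => //.
    apply: ends_frame.
    apply: (@ends_loop _ _ _ _ _ m 2 (fun k s' =>
      ints s' 10 0 = k /\ forall p, p < k -> ints s' 6 p = p)) => //.
      move=> k s' _ [ek _] [fi' _].
      by rewrite /= ek fi' // -ltnNge [ints s1 8 0]e8.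
    move=> k s' km [ek eq6] [fi' _].
    apply: ends_run => //=; rewrite /upd /= ek addn1.
    split=> // p; rewrite ltnS leq_eqVlt /=.
    by case: eqP => [->|] //= _ pk; exact: eq6.
  move=> s2 [[_ e6] [fi fr]]; apply: ends_run => //=; rewrite /upd /=.
  split; last by rewrite fr.
  have ea : mkseq (ints s2 6) m = iota 0 m.
    rewrite -[RHS]map_id; apply/eq_in_map => p; rewrite mem_iota => /andP[_].
    exact: e6.
  rewrite /sort_state /= -[mkseq _ m]/(mkseq (ints s2 6) m) ea; split=> //.
    by rewrite fi.
  by move=> l; case: (drop _ _) => [|? [|? ?]].
move=> s1 [st1 er1].
apply: (@ends_weaken _ _ _ _ _ (N * (m * 16 + 9).+1).+1 _
    (sort_state (reals s ka) m (2 ^ N))) => //; last first.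
  move=> s' [_ _ pa ba]; split=> //.
  have := ba 0; rewrite mul0n drop0 take_oversize // size_mkseq.
  exact: up_logP.
apply: (@ends_loop _ _ _ _ _ N (m * 16 + 9)
  (fun j => sort_state (reals s ka) m (2 ^ j))) => //.
  move=> j s' jN [e8' e9' _ _] _; rewrite /= e8' e9' -ltnNge.
  case: (ltnP j N) => h; last first.
    by apply/negbTE; rewrite -leqNgt (leq_trans (up_logP m (isT : 1 < 2))) // leq_pexp2l.
  have N0 : 0 < N by apply: leq_trans h.
  move: (N0); rewrite up_log_gt0 /= => m1.
  apply: leq_ltn_trans (up_log_gtn (isT : 1 < 2) m1).
  by rewrite leq_pexp2l // -ltnS prednK.
move=> j s' jN st [_ fr].
have er : reals s' ka = reals s ka by rewrite fr.
have := @width_stepP ka m (2 ^ j) s'; rewrite er expnS mul2n addnn; apply=> //.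
by rewrite expn_gt0.
Qed.

End SortCorrect.

(** * The algorithm *)

Section GreedyLayers.
Context {R : realType}.
Variables (m : nat) (x : nat -> nat) (B : nat -> R) (d : R).
Hypothesis d_ge0 : (0 <= d)%R.
Hypothesis B_incr : forall p q, p <= q < m -> (B (x p) <= B (x q))%R.
Local Open Scope nat_scope.

(** The vertices [x 0], ..., [x (k - 1)] have been placed, and [S] is the latitude at which layer
    [cur] was opened. The last two fields are the goal; the others make it inductive. *)
Record greedy (k : nat) (L : nat -> nat) (cur : nat) (S : R) : Prop := Greedy {
  greedy_max : forall p, p < k -> L (x p) <= cur;
  greedy_cur : forall p, p < k -> L (x p) = cur ->
    (S <= B (x p) <= S + d)%R;
  greedy_prev : forall p, p < k -> L (x p) < cur -> (B (x p) < S)%R;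
  greedy_far : forall p, p < k -> (L (x p)).+1 < cur -> (B (x p) + d < S)%R;
  greedy_next : forall q, k <= q < m -> (S <= B (x q))%R;
  greedy_width : forall p q, p < k -> q < k -> L (x p) = L (x q) ->
    (B (x q) <= B (x p) + d)%R;
  greedy_near : forall p q, p < k -> q < k -> (B (x q) <= B (x p) + d)%R ->
    L (x q) <= (L (x p)).+1
}.

Lemma greedy_extend k L L' cur cur' S S' : k < m ->
  greedy k L cur S -> (forall p, p < k -> L' (x p) = L (x p)) ->
  L' (x k) = cur' ->
  (if (B (x k) <= S + d)%R then cur' = cur /\ S' = S
   else cur' = cur.+1 /\ S' = B (x k)) ->
  greedy k.+1 L' cur' S'.
Proof.
move=> km [g1 g2 g3 g4 g5 g6 g7] oldL newL.
have Bk p : p < k -> (B (x p) <= B (x k))%R by move=> pk; apply: B_incr; lia.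
have Sk : (S <= B (x k))%R by apply: g5; rewrite leqnn.
have last_or p : p < k.+1 -> p = k \/ p < k by lia.
case: ifP => [le_k [ec eS]|/negbT]; last rewrite -ltNge => gt_k [ec eS].
- rewrite {}ec in newL *; subst S'.
  split.
  + by move=> p /last_or[->|pk]; [rewrite newL|rewrite oldL ?g1].
  + move=> p /last_or[->|pk]; first by move=> _; rewrite Sk le_k.
    by rewrite oldL //; exact: g2.
  + move=> p /last_or[->|pk]; first by rewrite newL ltnn.
    by rewrite oldL //; exact: g3.
  + move=> p /last_or[->|pk]; first by rewrite newL; lia.
    by rewrite oldL //; exact: g4.
  + by move=> q /andP[kq qm]; apply: g5; rewrite qm andbT; lia.
  + move=> p q /last_or[->|pk] /last_or[->|qk]; rewrite ?(oldL p) ?(oldL q) ?newL //.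
    * by move=> _; rewrite lerDl.
    * by move=> _; apply: le_trans (Bk _ qk) _; rewrite lerDl.
    * by move=> /(g2 _ pk)/andP[h _]; apply: le_trans le_k _; rewrite lerD2r.
    * exact: g6.
  + move=> p q /last_or[->|pk] /last_or[->|qk]; rewrite ?(oldL p) ?(oldL q) ?newL //.
    * by move=> _; apply: leqW; exact: g1.
    * move=> h; rewrite leqNgt; apply/negP => /(g4 _ pk) lt_S.
      by move: (le_lt_trans (le_trans Sk h) lt_S); rewrite ltxx.
    * exact: g7.
- have SB : (S < B (x k))%R by apply: le_lt_trans gt_k; rewrite lerDl.
  have lt_cur p : p < k -> (B (x p) < B (x k))%R.
    move=> pk; have := g1 _ pk; rewrite leq_eqVlt => /orP[/eqP|] h.
      by have /andP[_ h'] := g2 _ pk h; exact: le_lt_trans gt_k.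
    exact: lt_trans (g3 _ pk h) SB.
  (* A vertex below the old current layer has latitude less than [S], while the new one exceeds
     [S + d]. Hence layers at distance two are more than [d] apart. *)
  have far p : p < k -> L (x p) < cur -> (B (x p) + d < B (x k))%R.
    by move=> pk /(g3 _ pk) h; apply: lt_trans gt_k; rewrite ltrD2r.
  rewrite {}ec in newL *; subst S'; split.
  + move=> p /last_or[->|pk]; first by rewrite newL.
    by rewrite oldL // leqW // g1.
  + move=> p /last_or[->|pk]; first by move=> _; rewrite lexx lerDl.
    by rewrite oldL // => h; have := g1 _ pk; rewrite h ltnn.
  + move=> p /last_or[->|pk]; first by rewrite newL ltnn.
    by move=> _; exact: lt_cur.
  + move=> p /last_or[->|pk]; first by rewrite newL ltnNge leqnSn.
    by rewrite oldL // ltnS; exact: far.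
  + by move=> q /andP[kq qm]; apply: B_incr; rewrite qm andbT ltnW.
  + move=> p q /last_or[->|pk] /last_or[->|qk]; rewrite ?(oldL p) ?(oldL q) ?newL //.
    * by move=> _; rewrite lerDl.
    * by move=> h; have := g1 _ qk; rewrite -h ltnn.
    * by move=> h; have := g1 _ pk; rewrite h ltnn.
    * exact: g6.
  + move=> p q /last_or[->|pk] /last_or[->|qk]; rewrite ?(oldL p) ?(oldL q) ?newL //.
    * by move=> _; apply: leqW; apply: leqW; exact: g1.
    * move=> h; rewrite ltnS leqNgt; apply/negP => /(far _ pk) lt_S.
      by move: (le_lt_trans h lt_S); rewrite ltxx.
    * exact: g7.
Qed.

End GreedyLayers.

(** * Computing layers, interval endpoints and the output *)

Section MainProgram.
Local Open Scope nat_scope.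

(* Integer scalar 15 is the current layer; real array 3 holds the interval
   endpoints and real scalar 4 the smallest latitude of the current layer. *)
Definition layer_step : cmd :=
  Seq (If (RLe (RLoad 1 (ILoad 6 (var 10)))
             (RAdd (RLoad 4 (IConst 0))
                (RAdd (RLoad 0 (IConst 0)) (RLoad 0 (IConst 0)))))
          Skip
          (Seq (incr 15) (RStore 4 (IConst 0) (RLoad 1 (ILoad 6 (var 10))))))
  (Seq (IStore 5 (ILoad 6 (var 10)) (var 15)) (incr 10)).

(** Here [var 6] is the first vertex of the sorted permutation, so the sweep starts at the smallest
    latitude. *)
Definition layer_prog : cmd :=
  Seq (Seq (set_var 10 (IConst 0)) (Seq (set_var 15 (IConst 0))
           (RStore 4 (IConst 0) (RLoad 1 (var 6)))))
      (While (ilt (var 10) (var 8)) layer_step).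

Definition endpoint_prog : cmd :=
  Seq (set_var 10 (IConst 0))
      (While (ilt (var 10) (var 0))
         (Seq (RStore 3 (var 10) (InfAngle (var 10)))
         (Seq (RStore 3 (IAdd (var 10) (var 0)) (SupAngle (var 10)))
              (incr 10)))).

(** Node [a] has parent [a - 1] and a single difference, the vertex of event [a]. Insertions and
    deletions are written alike because a symmetric difference toggles membership. *)
Definition output_step : cmd :=
  Seq (IStore 2 (var 10) (ISub (var 10) (IConst 1)))
  (Seq (IStore 3 (var 10) (var 10))
  (Seq (If (ILe (var 0) (ILoad 6 (var 10)))
           (IStore 4 (var 10) (ISub (ILoad 6 (var 10)) (var 0)))
           (IStore 4 (var 10) (ILoad 6 (var 10))))
       (incr 10))).

(** The additional offset at [2n] closes the difference list of the last node. *)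
Definition output_prog : cmd :=
  Seq (set_var 10 (IConst 0))
  (Seq (While (ilt (var 10) (var 8)) output_step)
       (Seq (IStore 3 (var 8) (var 8)) (set_var 1 (var 8)))).

(** The same sort serves first for the [n] latitudes and then for the [2n] endpoints; the layers
    have left array 6 before it is overwritten. *)
Definition main_prog : cmd :=
  Seq (set_var 8 (var 0))
  (Seq (sort_prog 1)
  (Seq layer_prog
  (Seq endpoint_prog
  (Seq (set_var 8 (IAdd (var 0) (var 0)))
  (Seq (sort_prog 3) output_prog))))).

End MainProgram.

(** * Correctness and running time of the whole program *)

Section MainCorrect.
Context {R : realType}.
Variables inf_oracle sup_oracle : nat -> R.
Local Open Scope nat_scope.
Local Notation ends := (ends inf_oracle sup_oracle).
Local Notation run := (run inf_oracle sup_oracle).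

(** With [d = 2r], the first half gives the layering property and the second the width of a
    layer. *)
Definition layers_ok (m : nat) (B : nat -> R) (d : R) (L : nat -> nat) : Prop :=
  forall u v, u < m -> v < m ->
    ((B v <= B u + d)%R -> L v <= (L u).+1) /\
    (L u = L v -> (B v <= B u + d)%R).

Lemma layer_progP m s : ints s 8 0 = m -> (0 <= reals s 0 0)%R ->
  perm_eq (mkseq (ints s 6) m) (iota 0 m) ->
  sorted (lex (reals s 1)) (mkseq (ints s 6) m) ->
  ends layer_prog s (m * 6 + 4) (fun s' =>
    layers_ok m (reals s 1) (reals s 0 0 + reals s 0 0) (ints s' 5)).
Proof.
move=> e8 r0 pa sa; set x := ints s 6; set B := reals s 1.
set d := (reals s 0 0 + _)%R.
have d0 : (0 <= d)%R by rewrite addr_ge0.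
have B_incr p q : p <= q < m -> (B (x p) <= B (x q))%R.
  case/andP=> pq qm; have pm := leq_ltn_trans pq qm.
  have := sorted_leq_nth (@lex_trans _ B) (@lex_refl _ B) 0 sa p q.
  rewrite !inE !size_mkseq !nth_mkseq // => /(_ pm qm pq).
  by case/andP.
(* Injectivity ensures that writing a layer number never overwrites an earlier one; surjectivity
   then carries the result from positions to vertices. *)
have x_inj p q : p < m -> q < m -> x p = x q -> p = q.
  move=> pm qm exy.
  have u : uniq (mkseq x m) by rewrite (perm_uniq pa) iota_uniq.
  apply/eqP; rewrite -(nth_uniq 0 _ _ u) ?size_mkseq //.
  by rewrite !nth_mkseq // exy.
have x_surj u : u < m -> exists2 p, p < m & u = x p.
  move=> um; have : u \in mkseq x m by rewrite (perm_mem pa) mem_iota.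
  by case/mapP=> p; rewrite mem_iota => /andP[_ pm] ->; exists p.
apply: (@ends_weaken _ _ _ _ _ (3 + (m * 6).+1) _ (fun s' =>
    exists cur S, greedy m x B d m (ints s' 5) cur S)); last 1 first.
- move=> s' [cur [S [_ _ _ _ _ g6 g7]]] u v /x_surj[p pm ->] /x_surj[q qm ->].
  by split; [exact: g7|exact: g6].
- apply: ends_seq; apply: ends_run => //=; rewrite /upd /=; set s1 := Store _ _.
  apply: (@ends_weaken _ _ _ _ _ (m * 6).+1 _ (fun s' =>
    ints s' 10 0 = m /\
    greedy m x B d m (ints s' 5) (ints s' 15 0) (reals s' 4 0))) => //; last first.
    by move=> s' [_ g]; exists (ints s' 15 0), (reals s' 4 0).
  apply: (@ends_loop _ _ _ _ _ m 5 (fun k s' => ints s' 10 0 = k /\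
    greedy m x B d k (ints s' 5) (ints s' 15 0) (reals s' 4 0))) => //.
  + by split=> //; split=> // q /andP[_ qm]; apply: B_incr.
  + move=> k s' _ [ek _] [fi _].
    by rewrite /= ek fi // -ltnNge [ints s1 8 0]e8.
  + move=> k s' km [ek g] [fi fr]; apply: ends_run => //.
    have e6 : ints s' 6 = x by rewrite fi.
    have er1 : reals s' 1 = B by rewrite fr.
    have er0 : reals s' 0 = reals s 0 by rewrite fr.
    rewrite /= ek e6 er1 er0 -/d.
    case: ifP => hk /=; rewrite /upd /= ek e6 addn1; split=> //.
      apply: (greedy_extend d0 B_incr km g) => //; last by rewrite hk.
        move=> p pk; case: eqP => // /(x_inj _ _ (ltn_trans pk km) km) h.
        by move: pk; rewrite h ltnn.
      by rewrite eqxx.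
    apply: (greedy_extend d0 B_incr km g) => //; last by rewrite hk addn1.
      move=> p pk; case: eqP => // /(x_inj _ _ (ltn_trans pk km) km) h.
      by move: pk; rewrite h ltnn.
    by rewrite eqxx.
- lia.
Qed.

Lemma endpoint_progP n s : ints s 0 0 = n ->
  ends endpoint_prog s (n * 4 + 2) (fun s' => forall p, p < n ->
    reals s' 3 p = inf_oracle p /\ reals s' 3 (p + n) = sup_oracle p).
Proof.
move=> e0.
apply: (@ends_weaken _ _ _ _ _ (1 + (n * 4).+1) _ _ _ _ _ (fun _ h => h));
  last by lia.
apply: ends_seq; apply: ends_run => //=; rewrite /upd /=; set s1 := Store _ _.
apply: (@ends_weaken _ _ _ _ _ (n * 4).+1 _ (fun s' => ints s' 10 0 = n /\
  forall p, p < n ->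
    reals s' 3 p = inf_oracle p /\ reals s' 3 (p + n) = sup_oracle p)) => //;
  last by move=> ? [].
apply: (@ends_loop _ _ _ _ _ n 3 (fun k s' => ints s' 10 0 = k /\
  forall p, p < k ->
    reals s' 3 p = inf_oracle p /\ reals s' 3 (p + n) = sup_oracle p)) => //.
  move=> k s' _ [ek _] [fi _].
  by rewrite /= ek fi // -ltnNge [ints s1 0 0]e0.
move=> k s' kn [ek IH] [fi fr]; apply: ends_run => //.
have e0' : ints s' 0 0 = n by rewrite fi.
rewrite /= /upd /= ek e0' addn1; split=> // p.
rewrite ltnS leq_eqVlt => /orP[/eqP ->|pk].
  by rewrite !eqxx; case: eqP => // h; split=> //; lia.
have [h1 h2] := IH _ pk; rewrite eqn_add2r (ltn_eqF pk) h2.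
by rewrite !ifF //; apply/eqP; lia.
Qed.

Definition output_ok (n : nat) (l : seq nat) (s : store R) : Prop :=
  [/\ ints s 1 0 = n + n,
      forall a, a < n + n -> ints s 2 a = a.-1,
      forall a, a <= n + n -> ints s 3 a = a
    & forall a, a < n + n ->
        ints s 4 a = if nth 0 l a < n then nth 0 l a else nth 0 l a - n].

Lemma output_progP n s : ints s 0 0 = n -> ints s 8 0 = n + n ->
  ends output_prog s (n * 12 + 4) (output_ok n (mkseq (ints s 6) (n + n))).
Proof.
move=> e0 e8; set l := mkseq _ _; set m := n + n in e8 l *.
apply: (@ends_weaken _ _ _ _ _ (1 + ((m * 6).+1 + 2)) _ _ _ _ _ (fun _ h => h));
  last by lia.
apply: ends_seq; apply: ends_run => //=; rewrite /upd /=; set s1 := Store _ _.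
apply: ends_seq.
pose I k (s' : store R) := [/\ ints s' 10 0 = k,
  forall a, a < k -> ints s' 2 a = a.-1, forall a, a < k -> ints s' 3 a = a
  & forall a, a < k ->
    ints s' 4 a = if nth 0 l a < n then nth 0 l a else nth 0 l a - n].
apply: (@ends_weaken _ _ _ _ _ (m * 6).+1 _
    (fun s' => I m s' /\ frame (While (ilt (var 10) (var 8)) output_step) s1 s')) => //.
  apply: ends_frame; apply: (@ends_loop _ _ _ _ _ m 5 I) => //.
    move=> k s' _ [ek _ _ _] [fi _].
    by rewrite /= ek fi // -ltnNge [ints s1 8 0]e8.
  move=> k s' km [ek i2 i3 i4] [fi _]; apply: ends_run => //.
  have e0' : ints s' 0 0 = n by rewrite fi.
  have e6' : ints s' 6 = ints s 6 by rewrite fi.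
  have lk : nth 0 l k = ints s 6 k by exact: nth_mkseq.
  rewrite /= /upd /= ek e0' e6'; case: (leqP n (ints s 6 k)) => hk /=;
    rewrite /upd /= ?ek ?e6' ?e0' addn1; split=> //= a; rewrite ltnS leq_eqVlt;
    case: eqP => [->|] //= ak; rewrite ?subn1 //.
  + exact: i2.
  + exact: i3.
  + by rewrite lk ltnNge hk.
  + exact: i4.
  + exact: i2.
  + exact: i3.
  + by rewrite lk hk.
  + exact: i4.
move=> s2 [[_ i2 i3 i4] [fi _]]; apply: ends_run => //.
have e8' : ints s2 8 0 = m by rewrite fi.
rewrite /output_ok /= /upd /= e8'; split=> // a; rewrite leq_eqVlt.
by case: eqP => [->|] //= _; exact: i3.
Qed.

(** The oracles are arbitrary here: the program logic ends with a sorted list of events, and all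
    geometry is applied afterwards. *)
Lemma main_progP n (r : R) (b theta : 'I_n -> R) : 0 < n -> (0 <= r)%R ->
  ends main_prog (input r b theta) (200 * maxn 1 (n * up_log 2 n)) (fun s =>
    [/\ layers_ok n (extend b) (r + r) (ints s 5)
      & exists key l,
        [/\ forall p, p < n -> key p = inf_oracle p /\ key (p + n) = sup_oracle p,
            perm_eq l (iota 0 (n + n)), sorted (lex key) l & output_ok n l s]]).
Proof.
move=> n0 r0; set u := up_log 2 n.
apply: (@ends_weaken _ _ _ _ _ (1 + (sort_cost n + ((n * 6 + 4) + ((n * 4 + 2) +
  (1 + (sort_cost (n + n) + (n * 12 + 4))))))) _ _ _ _ _ (fun _ h => h)); last first.
  (* Doubling the length adds one round to the sort. The case [u = 0] is [n = 1], where the bound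
     comes from [maxn 1]. *)
  rewrite /sort_cost addnn up_log2_double // -/u.
  case: (posnP u) => [u0|u1].
    have : n <= 2 ^ u by exact: up_logP.
    rewrite u0 expn0 => n1; have -> : n = 1 by lia.
    by rewrite muln0.
  have : n <= n * u by rewrite leq_pmulr.
  have : u <= n * u by rewrite leq_pmull.
  have -> : u * (n * 16 + 10) = n * u * 16 + u * 10 by nia.
  have -> : u.+1 * (n.*2 * 16 + 10) = n * u * 32 + u * 10 + n * 32 + 10 by nia.
  move: (n * u) => q; lia.
apply: ends_seq; apply: ends_run => //=; rewrite /upd /=; set s1 := Store _ _.
apply: ends_seq.
apply: (ends_weaken (ends_frame (@sort_progP _ _ _ 1 n s1 _)) (leqnn _)) => //.
move=> s2 [[p2 o2] [fi2 fr2]]; rewrite -fr2 // in o2.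
have e8 : ints s2 8 0 = n by rewrite fi2.
have e0 : reals s2 0 0 = r by rewrite fr2.
apply: ends_seq.
apply: (ends_weaken (ends_frame (@layer_progP n s2 e8 _ p2 o2)) (leqnn _)) => //.
  by rewrite e0.
rewrite e0 fr2 // => s3 [lay [fi3 fr3]].
have e03 : ints s3 0 0 = n by rewrite fi3 // fi2.
apply: ends_seq.
apply: (ends_weaken (ends_frame (@endpoint_progP n s3 e03)) (leqnn _)) => //.
move=> s4 [key [fi4 fr4]].
have e04 : ints s4 0 0 = n by rewrite fi4.
apply: ends_seq; apply: ends_run => //=; rewrite /upd /= e04; set s5 := Store _ _.
apply: ends_seq.
apply: (ends_weaken (ends_frame (@sort_progP _ _ _ 3 (n + n) s5 _)) (leqnn _)) => //.
move=> s6 [[p6 o6] [fi6 fr6]].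
have e06 : ints s6 0 0 = n by rewrite fi6.
have e86 : ints s6 8 0 = n + n by rewrite fi6.
apply: (ends_weaken (ends_frame (@output_progP n s6 e06 e86)) (leqnn _)) => //.
move=> s7 [out [fi7 _]]; split.
  by rewrite fi7 // fi6 //= fi4.
by exists (reals s4 3), (mkseq (ints s6 6) (n + n)).
Qed.

End MainCorrect.

(** * From the output to a path decomposition *)

Section PathTree.
Local Open Scope nat_scope.
Context (N : nat) (t : rel 'I_N).
Hypothesis t_path : forall a b : 'I_N, t a b = (a.+1 == b) || (b.+1 == a).

Lemma path_sym : symmetric t.
Proof. by move=> a b; rewrite !t_path orbC. Qed.

(** Walk through consecutive integers. A trivial [P] gives connectedness of the tree, and membership
    in a bag gives connectedness of the nodes of a vertex. *)
Lemma path_connect_in (P : pred 'I_N) (a b : 'I_N) :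
  (forall x : 'I_N, minn a b <= x <= maxn a b -> P x) ->
  connect [rel x y | [&& t x y, P x & P y]] a b.
Proof.
wlog le_ab : a b / a <= b => [wl|].
  move=> Pab; case: (leqP a b) => [|/ltnW] le_ab; first exact: wl.
  rewrite (sym_connect_sym _); first by apply: wl => // x; rewrite minnC maxnC; exact: Pab.
  by move=> x y /=; rewrite path_sym [P x && _]andbC.
rewrite (minn_idPl le_ab) (maxn_idPr le_ab).
have [d dE] : exists d, b - a = d by exists (b - a).
elim: d b le_ab dE => [|d IH] b le_ab dE Pab.
  by have -> : a = b by [apply: val_inj => /=; lia]; exact: connect0.
have b0 : 0 < b by lia.
have b'N : b.-1 < N by have := ltn_ord b; lia.
pose b' := Ordinal b'N.
apply: (connect_trans (IH b' _ _ _)) => /=; try lia.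
  by move=> x /andP[ax xb]; apply: Pab; lia.
apply: connect1; rewrite /= t_path /= prednK // eqxx /=.
by rewrite !Pab //=; lia.
Qed.

(** The largest vertex of a cycle would have two distinct neighbours below it, but in a path it has
    at most one. *)
Lemma path_is_tree : 0 < N -> is_tree t.
Proof.
move=> N0; split.
- split; first exact: path_sym.
  by move=> a; rewrite t_path orbb; apply/eqP; lia.
- by rewrite card_ord.
- move=> a b; have := @path_connect_in predT a b (fun _ _ => isT).
  by apply: connect_sub => x y /= /andP[txy _]; exact: connect1.
- move=> p /andP[cp up]; rewrite ltnNge; apply/negP => sp.
  case: p => [//|x0 p0] in cp up sp *.
  pose x := [arg max_(i > x0 in x0 :: p0) nat_of_ord i].
  have [xp xmax] : x \in x0 :: p0 /\ forall y, y \in x0 :: p0 -> y <= x.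
    by rewrite /x; case: arg_maxnP => [|i ip imax]; [exact: mem_head|split].
  have [i q eq] := rot_to xp.
  have cq : cycle t (x :: q) by rewrite -eq rot_cycle.
  have uq : uniq (x :: q) by rewrite -eq rot_uniq.
  have sq : 2 < size (x :: q) by rewrite -eq size_rot.
  have mq y : y \in q -> y < x.
    move=> yq; have : y \in x0 :: p0 by rewrite -(mem_rot i) eq inE yq orbT.
    move=> /xmax; rewrite leq_eqVlt => /orP[/eqP/val_inj yx|//].
    by move: uq; rewrite /= -yx yq.
  case: q => [//|y q] in eq cq uq sq mq *.
  case/lastP: q => [//|q z] in eq cq uq sq mq *.
  move: cq; rewrite /= rcons_path last_rcons => /andP[txy /andP[_ tzx]].
  have yx : y < x by apply: mq; rewrite mem_head.
  have zx : z < x by apply: mq; rewrite inE mem_rcons mem_head orbT.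
  move: uq => /= /and3P[_ + _]; rewrite mem_rcons inE negb_or => /andP[+ _].
  case/negP; apply/eqP/val_inj => /=.
  by move: txy tzx; rewrite !t_path; lia.
Qed.

End PathTree.

Lemma out_wf_events (R : realType) (n : nat) (l : seq nat) (s : store R) :
  output_ok n l s -> out_wf s.
Proof.
move=> [sz par off _]; split=> a; rewrite /out_size sz => h.
  by rewrite /out_parent par; lia.
by rewrite /out_offset !off; lia.
Qed.

(** * Bags described by the sorted endpoints *)

Section OutputTree.
Context {R : realType}.
Local Open Scope nat_scope.
Variables (n : nat) (s : store R) (key : nat -> R) (l : seq nat).
Variables lo hi : 'I_n -> R.
Hypothesis n_gt0 : 0 < n.
Hypothesis key_lo : forall v : 'I_n, key v = lo v.
Hypothesis key_hi : forall v : 'I_n, key (v + n) = hi v.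
Hypothesis lo_hi : forall v, (lo v <= hi v)%R.
Hypothesis l_perm : perm_eq l (iota 0 (n + n)).
Hypothesis l_sorted : sorted (lex key) l.
Hypothesis s_out : output_ok n l s.

Definition start (v : 'I_n) : nat := index (nat_of_ord v) l.
Definition stop (v : 'I_n) : nat := index (v + n) l.

Lemma mem_events x : (x \in l) = (x < n + n).
Proof. by rewrite (perm_mem l_perm) mem_iota. Qed.

Lemma uniq_events : uniq l.
Proof. by rewrite (perm_uniq l_perm) iota_uniq. Qed.

Lemma size_events : size l = n + n.
Proof. by rewrite (perm_size l_perm) size_iota. Qed.

(** Antisymmetry of [lex] excludes ties, which makes sortedness an equivalence. *)
Lemma index_events x y : x < n + n -> y < n + n ->
  (index x l <= index y l) = lex key x y.
Proof.
rewrite -!mem_events => xl yl; apply/idP/idP.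
  exact: (sorted_leq_index (@lex_trans _ key) (@lex_refl _ key) l_sorted) xl yl.
move=> xy; rewrite leqNgt; apply/negP => lt_yx.
have yx := (sorted_leq_index (@lex_trans _ key) (@lex_refl _ key) l_sorted)
  _ _ yl xl (ltnW lt_yx).
have exy : x = y by apply: (@lex_anti _ key); rewrite xy yx.
by move: lt_yx; rewrite exy ltnn.
Qed.

Lemma start_lt v : start v < n + n.
Proof. by rewrite -size_events index_mem mem_events; have := ltn_ord v; lia. Qed.

(** If the two endpoints coincide, [u < n <= v + n] makes the tie rule put the insertion first. *)
Lemma start_stop (u v : 'I_n) : (lo u <= hi v)%R -> start u < stop v.
Proof.
move=> uv; have := ltn_ord u; have := ltn_ord v => vn un.
rewrite ltn_neqAle; apply/andP; split.
  apply/eqP => /(congr1 (nth 0 l)); rewrite !nth_index ?mem_events; lia.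
rewrite index_events; try lia.
by rewrite /lex key_lo key_hi uv /= negb_and negbK; apply/orP; right; lia.
Qed.

Lemma out_entryE a (v : 'I_n) : a < n + n ->
  (out_entry s a == v) = (a == start v) || (a == stop v).
Proof.
move=> an; rewrite /out_entry; case: s_out => _ _ _ ->//.
have idx x : x < n + n -> (a == index x l) = (nth 0 l a == x).
  move=> xn; apply/eqP/eqP => [->|<-]; first by rewrite nth_index ?mem_events.
  by rewrite index_uniq ?uniq_events ?size_events.
have vn := ltn_ord v.
rewrite /start /stop !idx; try lia.
have : nth 0 l a < n + n by rewrite -mem_events mem_nth ?size_events.
by case: (ltnP (nth 0 l a) n) => h1 h2; lia.
Qed.

(** Along the path each vertex is toggled twice, first at [start v] and later at [stop v]. *)
Lemma out_bag_recE a (v : 'I_n) : a < n + n ->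
  (v \in out_bag_rec s n a.+1 a) = (start v <= a < stop v).
Proof.
have [_ par off _] := s_out.
have se := start_stop (lo_hi v).
elim: a => [|a IH] an.
  rewrite /= /symdiff !inE /= /out_offset !off //.
  by rewrite /index_iota /= orbF out_entryE //; lia.
rewrite -[out_bag_rec _ _ _ _]/(symdiff
  (out_bag_rec s n a.+1 (out_parent s a.+1)) (out_diff s n a.+1)).
have -> : out_parent s a.+1 = a by rewrite /out_parent par.
rewrite /symdiff !finset.in_setU !finset.in_setD IH ?(ltnW an) // inE.
rewrite /out_offset !off ?(ltnW an) //.
rewrite /index_iota subSnn /= orbF out_entryE //.
by lia.
Qed.

Lemma out_tree_path (a b : 'I_(out_size s)) :
  out_tree a b = (a.+1 == b) || (b.+1 == a).
Proof.
have [sz par _ _] := s_out.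
have := ltn_ord a; have := ltn_ord b; rewrite {2 4}/out_size sz => bn an.
by rewrite /out_tree /out_parent !par //; lia.
Qed.

Lemma out_bagE (a : 'I_(out_size s)) (v : 'I_n) :
  (v \in out_bag n a) = (start v <= a < stop v).
Proof.
have [sz _ _ _] := s_out; rewrite /out_bag out_bag_recE //.
by have := ltn_ord a; rewrite {2}/out_size sz.
Qed.

Lemma out_tree_decomposition (e : rel 'I_n) :
  (forall u v, e u v -> (lo u <= hi v)%R /\ (lo v <= hi u)%R) ->
  tree_decomposition e (@out_tree R s) (@out_bag R s n).
Proof.
move=> e_lohi; have [sz _ _ _] := s_out.
have node i : i < n + n -> i < out_size s by rewrite /out_size sz.
split.
- apply: path_is_tree; first exact: out_tree_path.
  by rewrite /out_size sz; lia.
- move=> u; exists (Ordinal (node _ (start_lt u))).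
  by rewrite out_bagE /= leqnn start_stop.
- move=> u v /e_lohi[uv vu].
  have m_lt : maxn (start u) (start v) < n + n by rewrite gtn_max !start_lt.
  (* The later of the two insertions precedes both deletions. *)
  exists (Ordinal (node _ m_lt)); rewrite !out_bagE /=.
  rewrite leq_maxl leq_maxr !gtn_max.
  by rewrite !start_stop.
- move=> u a b; rewrite !out_bagE => ua ub.
  apply: (path_connect_in out_tree_path (P := fun x => u \in out_bag n x)).
  by move=> x ax; rewrite out_bagE; lia.
Qed.

(** The link to geometry: the intervals of one bag share a point, the key of the event of that
    node. *)
Lemma out_bag_key (a : 'I_(out_size s)) (v : 'I_n) :
  v \in out_bag n a -> (lo v <= key (nth 0 l a) <= hi v)%R.
Proof.
have [sz _ _ _] := s_out.
have an : a < n + n by have := ltn_ord a; rewrite {2}/out_size sz.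
have ea : index (nth 0 l a) l = a by rewrite index_uniq ?uniq_events ?size_events.
have la : nth 0 l a < n + n by rewrite -mem_events mem_nth ?size_events.
have vn := ltn_ord v.
rewrite out_bagE => /andP[]; rewrite -{1 2}ea => h1 /ltnW h2.
move: h1 h2; rewrite !index_events; try lia.
by move=> /andP[+ _] /andP[+ _]; rewrite key_lo key_hi => -> ->.
Qed.

End OutputTree.

(** * Spherical geometry *)

Section Trigonometry.
Context {R : realType}.
Local Open Scope ring_scope.
Implicit Types x y r : R.

Lemma cos_ge_norm x r : 0 <= r -> `|x| <= pi -> cos r <= cos x -> `|x| <= r.
Proof.
move=> r0 xpi; apply: contraTT; rewrite -!ltNge => rx.
rewrite -[cos x]cos_norm ltr_cos // in_itv /= ?normr_ge0 // r0.
exact: ltW (lt_le_trans rx xpi).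
Qed.

Lemma norm_cos_ge x r : `|x| <= r -> r <= pi -> cos r <= cos x.
Proof.
move=> xr rpi; rewrite -[cos x]cos_norm leNgt.
have x0 := normr_ge0 x.
rewrite ltr_cos ?in_itv /= -?leNgt //; first by rewrite (le_trans x0 xr).
by rewrite x0 (le_trans xr rpi).
Qed.

Lemma cos_2piB x : cos (2 * pi - x) = cos x.
Proof. by rewrite addrC mulr_natl cosD2pi cosN. Qed.

(** Differences of angles in [0, 2 pi[ may wrap around, which is the second alternative. *)
Lemma cos_ge_cases x r : 0 <= r <= pi -> `|x| <= 2 * pi -> cos r <= cos x ->
  `|x| <= r \/ 2 * pi - r <= `|x|.
Proof.
move=> /andP[r0 rpi] x2pi; rewrite -[cos x]cos_norm => h.
have x0 := normr_ge0 x.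
case: (leP `|x| pi) => xpi; [left|right].
  by move: (@cos_ge_norm `|x| r r0); rewrite normr_id => ->.
have := @cos_ge_norm (2 * pi - `|x|) r r0; rewrite cos_2piB.
by rewrite ger0_norm; [move=> /(_ _ h); lra | lra].
Qed.

Lemma sqr_sum_cos_sin x y : x ^+ 2 + y ^+ 2 = 1 ->
  exists2 th, 0 <= th < 2 * pi & cos th = x /\ sin th = y.
Proof.
move=> xy; have pi0 := pi_gt0 R.
have x1 : -1 <= x <= 1 by apply/andP; split; nra.
have a0 := acos_ge0 x1; have api := acos_lepi x1.
have ca : cos (acos x) = x by rewrite acosK.
have sa : sin (acos x) = `|y|.
  by rewrite sin_acos // -xy addrC addKr sqrtr_sqr.
case: (leP 0 y) => y0.
  by exists (acos x); [lra | rewrite ca sa ger0_norm].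
have a1 : acos x != 0.
  apply/eqP => a1; move: sa y0; rewrite a1 sin0 => /esym/eqP.
  by rewrite normr_eq0 => /eqP ->; rewrite ltxx.
exists (2 * pi - acos x).
  have a2 : 0 < acos x by rewrite lt_neqAle eq_sym a1.
  lra.
rewrite cos_2piB ca addrC mulr_natl sinD2pi sinN sa ltr0_norm //.
by rewrite opprK.
Qed.

(** It turns [x * cos t + y * sin t] into [M * cos (t - s)], whose maximum is attained strictly
    between 0 and pi, that is, away from the poles. *)
Lemma upper_polar_form x y : 0 < y -> exists M s,
  [/\ 0 < M, 0 < s < pi, x = M * cos s, y = M * sin s
    & M ^+ 2 = x ^+ 2 + y ^+ 2].
Proof.
move=> y0; have pi0 := pi_gt0 R; set q := x ^+ 2 + y ^+ 2.
have q0 : 0 < q by rewrite /q; nra.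
set M := Num.sqrt q; have M0 : 0 < M by rewrite sqrtr_gt0.
have M2 : M ^+ 2 = q by rewrite sqr_sqrtr // ltW.
have [|th /andP[th0 th2] [cth sth]] := @sqr_sum_cos_sin (x / M) (y / M).
  by rewrite !expr_div_n -mulrDl -/q -M2 divff // expf_neq0 // gt_eqF.
have sgt0 : 0 < sin th by rewrite sth divr_gt0.
have Mn0 : M != 0 by rewrite gt_eqF.
have thpi : th < pi.
  rewrite ltNge; apply/negP => pith; move: sgt0; apply/negP; rewrite -leNgt.
  have -> : th = (th - pi) + pi by ring.
  by rewrite sinDpi oppr_le0 sin_ge0_pi //; lra.
have thgt0 : 0 < th.
  rewrite lt_neqAle th0 andbT; apply/eqP => e; move: sgt0.
  by rewrite -e sin0 ltxx.
exists M, th; rewrite thgt0 thpi cth sth M2; clearbody M.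
by split; rewrite // mulrC divfK.
Qed.

End Trigonometry.

(** * Orthonormal and polar coordinates *)

Section Frame.
Context {R : realType} (F : polar_frame R).
Local Open Scope ring_scope.
Implicit Types p q : 'rV[R]_3.

Lemma dotC p q : dot p q = dot q p.
Proof. by apply: eq_bigr => i _; rewrite mulrC. Qed.

Lemma dotDl p1 p2 q : dot (p1 + p2) q = dot p1 q + dot p2 q.
Proof. by rewrite -big_split; apply: eq_bigr => i _; rewrite mxE mulrDl. Qed.

Lemma dotZl (k : R) p q : dot (k *: p) q = k * dot p q.
Proof. by rewrite mulr_sumr; apply: eq_bigr => i _; rewrite mxE mulrA. Qed.

Lemma dotDr p q1 q2 : dot p (q1 + q2) = dot p q1 + dot p q2.
Proof. by rewrite dotC dotDl !(dotC p). Qed.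

Lemma dotZr (k : R) p q : dot p (k *: q) = k * dot p q.
Proof. by rewrite dotC dotZl dotC. Qed.

Lemma dotNr p q : dot p (- q) = - dot p q.
Proof. by rewrite -scaleN1r dotZr mulN1r. Qed.

Lemma dotNl p q : dot (- p) q = - dot p q.
Proof. by rewrite dotC dotNr dotC. Qed.

(** Expand the squared lengths of [p + q] and [p - q]. *)
Lemma dot_unit_bounds p q : sphere p -> sphere q -> -1 <= dot p q <= 1.
Proof.
rewrite /sphere /= => p1 q1.
have sq u : 0 <= dot u u :> R by apply: sumr_ge0 => i _; rewrite -expr2 sqr_ge0.
have := sq (p + q); have := sq (p - q).
by rewrite !(dotDl, dotDr, dotNr, dotNl) p1 q1 (dotC q p); lra.
Qed.

Definition point (x y z : R) : 'rV[R]_3 :=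
  x *: pole F + y *: axis_dir F + z *: turn_dir F.

Lemma dot_point x1 y1 z1 x2 y2 z2 :
  dot (point x1 y1 z1) (point x2 y2 z2) = x1 * x2 + y1 * y2 + z1 * z2.
Proof.
have [] := polar_frame_unit F; rewrite /sphere /= => oo aa tt.
have [poa pot pat] := polar_frame_orthogonal F.
rewrite !(dotDl, dotDr, dotZl, dotZr) oo aa tt poa pot pat.
by rewrite (dotC _ (pole F)) poa (dotC _ (pole F)) pot (dotC (turn_dir F)) pat; ring.
Qed.

Lemma pole_point : pole F = point 1 0 0.
Proof. by rewrite /point scale1r !scale0r !addr0. Qed.

(** The matrix with the frame as rows is orthogonal; a right inverse of a square matrix is also a
    left inverse, so [p] equals [p *m M^T *m M]. *)
Lemma point_complete p :
  p = point (dot p (pole F)) (dot p (axis_dir F)) (dot p (turn_dir F)).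
Proof.
pose M : 'M[R]_3 := \matrix_(i < 3) [:: pole F; axis_dir F; turn_dir F]`_i.
have MMT : M *m M^T = 1%:M.
  have [] := polar_frame_unit F; rewrite /sphere /= => oo aa tt.
  have [poa pot pat] := polar_frame_orthogonal F.
  apply/matrixP => i j.
  have -> : (M *m M^T) i j = dot (row i M) (row j M).
    by rewrite mxE; apply: eq_bigr => k _; rewrite !mxE.
  rewrite !rowK mxE.
  case: i j => [[|[|[|//]]] ?] [[|[|[|//]]] ?] /=;
    by rewrite ?oo ?aa ?tt ?poa ?pot ?pat // dotC ?poa ?pot ?pat.
rewrite -[LHS]mulmx1 -(mulmx1C MMT) mulmxA mulmx_sum_row.
rewrite !big_ord_recl big_ord0 addr0 /point addrA !rowK /=.
have coef (i : 'I_3) : (p *m M^T) 0 i = dot p (row i M).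
  by rewrite mxE; apply: eq_bigr => k _; rewrite !mxE.
by rewrite !coef !rowK.
Qed.

Lemma polar_point p b th : polar_coord F p b th ->
  p = point (cos b) (sin b * cos th) (sin b * sin th).
Proof. by case=> _ _ ->; rewrite /point scalerDr !scalerA addrA. Qed.

Lemma polar_coordP p b th : polar_coord F p b th -> sphere p ->
  [/\ 0 <= b <= pi, 0 <= th < 2 * pi &
   p = point (cos b) (sin b * cos th) (sin b * sin th)].
Proof.
move=> pc p1; have := polar_point pc; case: pc => -> thP _ pE; split=> //.
have [pole1 _ _] := polar_frame_unit F.
have h := dot_unit_bounds p1 pole1.
by apply/andP; split; [exact: acos_ge0|exact: acos_lepi].
Qed.

Lemma polar_coord_exists p : sphere p ->
  exists th, polar_coord F p (sdist p (pole F)) th.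
Proof.
move=> p1; have [pole1 _ _] := polar_frame_unit F.
set x := dot p (pole F); have xb := dot_unit_bounds p1 pole1; rewrite -/x in xb.
have b0 := acos_ge0 xb; have bpi := acos_lepi xb.
have cb : cos (acos x) = x by rewrite acosK.
have pE := point_complete p; rewrite -/x in pE.
set y := dot p _ in pE; set z := dot p _ in pE.
have xyz : x * x + y * y + z * z = 1 by rewrite -dot_point -pE.
have s0 : 0 <= sin (acos x) by rewrite sin_ge0_pi // b0.
have s2 : sin (acos x) ^+ 2 = y ^+ 2 + z ^+ 2.
  by rewrite sin2cos2 cb; lra.
(* At a pole the other two coordinates vanish, and the angle is chosen to be 0. *)
case: (eqVneq (sin (acos x)) 0) => [se|sn].
  have y0 : y = 0 by rewrite se in s2; nra.
  have z0 : z = 0 by rewrite se in s2; nra.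
  exists 0; split=> //; first by rewrite lexx /= mulr_gt0 // pi_gt0.
  by rewrite /sdist -/x cb se scale0r addr0 {1}pE y0 z0 /point !scale0r !addr0.
have [|th thP [cth sth]] := @sqr_sum_cos_sin _ (y / sin (acos x)) (z / sin (acos x)).
  by rewrite !expr_div_n -mulrDl -s2 divff // expf_neq0.
exists th; split=> //.
rewrite /sdist -/x cb cth sth scalerDr !scalerA !(mulrC (sin _)) !divfK //.
by rewrite addrA {1}pE.
Qed.

Lemma sdist_le p q r : sphere p -> sphere q -> 0 <= r <= pi ->
  (sdist p q <= r) = (cos r <= dot p q).
Proof.
move=> p1 q1 r0pi; have b := dot_unit_bounds p1 q1.
rewrite /sdist -[in RHS](@acosK _ (dot p q)) //.
rewrite leNgt -ltr_cos ?in_itv /= ?acos_ge0 ?acos_lepi //.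
by rewrite -leNgt.
Qed.

End Frame.

(** * The half-meridians met by a disk *)

Section Disk.
Context {R : realType} (F : polar_frame R) (r : R).
Hypothesis r_bounds : (0 < r < pi)%R.
Local Open Scope ring_scope.
Local Open Scope classical_set_scope.

Definition meridian (psi s : R) : 'rV[R]_3 :=
  point F (cos s) (sin s * cos psi) (sin s * sin psi).

Lemma meridian_sphere psi s : sphere (meridian psi s).
Proof.
rewrite /sphere /= dot_point.
have := cos2Dsin2 s; have := cos2Dsin2 psi; rewrite !expr2 => hp hs.
rewrite -[RHS]hs -[sin s * sin s]mulr1 -hp; ring.
Qed.

Lemma meridian_polar psi s : 0 <= s <= pi -> 0 <= psi < 2 * pi ->
  polar_coord F (meridian psi s) s psi.
Proof.
move=> sb psib; split=> //; last by rewrite /meridian /point scalerDr !scalerA addrA.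
rewrite /sdist [pole F](pole_point F) dot_point !mulr0 !addr0 mulr1 cosK //.
Qed.

Lemma dot_meridian psi s psi' s' : dot (meridian psi s) (meridian psi' s') =
  cos s * cos s' + sin s * sin s' * cos (psi - psi').
Proof. by rewrite dot_point cosB; ring. Qed.

(** The strict bounds on [s] keep the point off the poles, where it has no angle. *)
Lemma angles_meridian c psi s : sphere c -> 0 < s < pi -> 0 <= psi < 2 * pi ->
  cos r <= dot (meridian psi s) c -> angles F (sdisk r c) psi.
Proof.
move=> c1 sb psib hc; have ms := meridian_sphere psi s.
have rb : 0 <= r <= pi by case/andP: r_bounds => /ltW -> /ltW ->.
have sb' : 0 <= s <= pi by lra.
have dp : dot (meridian psi s) (pole F) = cos s.
  by rewrite [pole F](pole_point F) dot_point !mulr0 !addr0 mulr1.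
have pp : dot (pole F) (pole F) = 1 by have [] := polar_frame_unit F.
have pi0 := pi_gt0 R.
exists (meridian psi s); split.
- by split=> //; rewrite sdist_le.
- apply/eqP => e; move: dp; rewrite e pp -cos0 => /cos_inj h.
  by move: sb; rewrite -h ?ltxx // in_itv /= ?sb' ?lexx ?ltW.
- apply/eqP => e; move: dp; rewrite e dotNl pp -cospi => /cos_inj h.
  by move: sb; rewrite -h ?ltxx ?andbF // in_itv /= ?sb' ?lexx ?ltW.
- have mp := meridian_polar sb' psib.
  by have [e _ _] := mp; rewrite -e.
Qed.

Lemma disk_meridian c x psi : sphere c -> sdisk r c x ->
    polar_coord F x (sdist x (pole F)) psi ->
  [/\ 0 <= sdist x (pole F) <= pi, x = meridian psi (sdist x (pole F))
    & cos r <= dot x c].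
Proof.
move=> c1 [x1 xr] xp; have rb : 0 <= r <= pi by case/andP: r_bounds => /ltW -> /ltW ->.
by have [sb _ xE] := polar_coordP xp x1; split; rewrite -?sdist_le.
Qed.

Section Center.
Variables (c : 'rV[R]_3) (b th : R).
Hypotheses (c_sphere : sphere c) (c_polar : polar_coord F c b th).

Let b_bounds : 0 <= b <= pi.
Proof. by have [] := polar_coordP c_polar c_sphere. Qed.

Let th_bounds : 0 <= th < 2 * pi.
Proof. by have [] := polar_coordP c_polar c_sphere. Qed.

Let cE : c = meridian th b.
Proof. by have [] := polar_coordP c_polar c_sphere. Qed.

Let sinb_ge0 : 0 <= sin b.
Proof. exact: sin_ge0_pi. Qed.

(** Spherical law of cosines: the cosine of the distance from the center to the point at polar
    distance [s] on the half-meridian at [psi]. *)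
Definition lat_cos psi s : R := cos b * cos s + sin b * sin s * cos (psi - th).

Lemma dot_meridian_center psi s : dot (meridian psi s) c = lat_cos psi s.
Proof. by rewrite {1}cE dot_meridian /lat_cos; ring. Qed.

(** Since [cos (psi - th) <= 1], the law of cosines gives at most [cos (s - b)]. *)
Lemma latitude_disk x : sdisk r c x -> `|sdist x (pole F) - b| <= r.
Proof.
have rB := r_bounds; have bB := b_bounds; have thB := th_bounds.
move=> xc; have [psi xp] := polar_coord_exists F (proj1 xc).
have [sb xE hx] := disk_meridian c_sphere xc xp.
set s := sdist x (pole F) in sb xE *.
rewrite xE dot_meridian_center /lat_cos in hx.
apply: cos_ge_norm; [lra | by rewrite ler_norml; lra|].
apply: (le_trans hx); rewrite cosB.
have ss : 0 <= sin s by exact: sin_ge0_pi.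
have := cos_le1 (psi - th); have := mulr_ge0 sinb_ge0 ss; nra.
Qed.

(* [M] is the maximum of [lat_cos psi] on the half-meridian, attained at [s0]. *)
Lemma lat_cos_form psi : 0 < sin b -> 0 < cos (psi - th) -> exists M s0,
  [/\ 0 < M, 0 < s0 < pi, cos b = M * cos s0,
      sin b * cos (psi - th) = M * sin s0
    & M ^+ 2 = cos b ^+ 2 + (sin b * cos (psi - th)) ^+ 2].
Proof. by move=> sb cp; apply: upper_polar_form; exact: mulr_gt0. Qed.

Lemma lat_cosE psi M s0 s : cos b = M * cos s0 ->
  sin b * cos (psi - th) = M * sin s0 -> lat_cos psi s = M * cos (s - s0).
Proof.
move=> e1 e2; rewrite /lat_cos cosB mulrDr.
rewrite (_ : sin b * sin s * _ = (sin b * cos (psi - th)) * sin s); last by ring.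
by rewrite e1 e2; ring.
Qed.

(** The nearest point of a half-meridian at an acute angle from the center is not a pole, and its
    cosine [M] is at least [|cos b|], and is 1 if [psi = th]. If the center is a pole, the point at
    distance [r] from it is used instead. *)
Lemma angles_visible psi : 0 <= psi < 2 * pi -> 0 < cos (psi - th) ->
  (cos r <= `|cos b|) || (psi == th) -> angles F (sdisk r c) psi.
Proof.
have rB := r_bounds; have bB := b_bounds; have thB := th_bounds.
move=> psib cp near.
have inA s : 0 < s < pi -> cos r <= lat_cos psi s -> angles F (sdisk r c) psi.
  by move=> sb h; apply: (@angles_meridian c psi s) => //; rewrite dot_meridian_center.
move: sinb_ge0; rewrite le_eqVlt => /predU1P[sb0|sb].
  have : `|cos b| = 1 by exact: sin0cos1.
  case: (leP 0 (cos b)) => cb; [rewrite ger0_norm // | rewrite ltr0_norm //] => e.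
    by apply: (inA r) => //; rewrite /lat_cos -sb0 !mul0r addr0 e mul1r.
  apply: (inA (pi - r)); first by lra.
  rewrite /lat_cos -sb0 !mul0r addr0 addrC cosDpi cosN.
  have -> : cos b = -1 by lra.
  by rewrite mulN1r opprK.
have [M [s0 [M0 s0b e1 e2 M2]]] := lat_cos_form sb cp.
apply: (inA s0) => //; rewrite (lat_cosE _ e1 e2) subrr cos0 mulr1.
case/orP: near => [near|/eqP e].
  apply: le_trans near _; rewrite -ler_sqr ?nnegrE ?normr_ge0 ?(ltW M0) //.
  by rewrite real_normK ?num_real // M2 lerDl sqr_ge0.
have -> : M = 1; last exact: cos_le1.
apply/eqP; rewrite -(@eqrXn2 _ 2) ?ler01 ?(ltW M0) // expr1n M2 e subrr cos0 mulr1.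
by rewrite cos2Dsin2.
Qed.

Let A := angles F (sdisk r c).

(** Valid even if the center is a pole, with whatever angle its coordinates carry; hence the set of
    angles is never empty. *)
Lemma angles_center : A th.
Proof. by apply: angles_visible; rewrite ?subrr ?cos0 ?ltr01 ?eqxx ?orbT. Qed.

Lemma angles_range psi : A psi -> 0 <= psi < 2 * pi.
Proof. by move=> [x [_ _ _ []]]. Qed.

Lemma angles_inf_sup psi : A psi ->
  inf_angle F (sdisk r c) <= psi <= sup_angle F (sdisk r c).
Proof.
move=> Ap; apply/andP; split.
  by apply: ge_inf => //; exists 0 => y /angles_range/andP[].
by apply: ub_le_sup => //; exists (2 * pi) => y /angles_range/andP[_ /ltW].
Qed.

Lemma inf_le_sup_angle : inf_angle F (sdisk r c) <= sup_angle F (sdisk r c).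
Proof. by have /andP[] := angles_inf_sup angles_center; exact: le_trans. Qed.

(* A disk containing a pole is visible under every angle of an open half-turn,
   and a half-turn inside [0, 2 pi] contains pi; one crossing the polar axis
   spans all of [0, 2 pi]. *)
Lemma pole_disk_angles : cos r <= `|cos b| ->
  inf_angle F (sdisk r c) <= pi <= sup_angle F (sdisk r c).
Proof.
have rB := r_bounds; have bB := b_bounds; have thB := th_bounds.
move=> near; have pi0 := pi_gt0 R.
have inA psi : 0 <= psi < 2 * pi -> 0 < cos (psi - th) ->
    inf_angle F (sdisk r c) <= psi <= sup_angle F (sdisk r c).
  by move=> h1 h2; apply: angles_inf_sup; apply: angles_visible; rewrite ?near.
have c0 x : - (pi / 2) < x < pi / 2 -> 0 < cos x by exact: cos_gt0_pihalf.
have inth : inf_angle F (sdisk r c) <= th <= sup_angle F (sdisk r c).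
  by apply: inA => //; rewrite subrr cos0.
move: inA inth; set lo := inf_angle _ _; set hi := sup_angle _ _ => inA inth.
apply/andP; split; rewrite leNgt; apply/negP => lt_pi.
(* If the infimum exceeded pi, then either the disk would be visible across the axis at angle 0, or
   the midpoint of [m] and [th - pi / 2] would be a visible angle below the infimum. *)
- have [th2|th2] := ltP (3 * (pi / 2)) th.
    have /andP[] : lo <= 0 <= hi.
      by apply: inA; [lra|rewrite sub0r cosN -cos_2piB; apply: c0; lra].
    lra.
  pose m := Num.min lo th.
  pose psi := (m + (th - pi / 2)) / 2.
  have mlo : m <= lo by rewrite ge_min lexx.
  have mth : m <= th by rewrite ge_min lexx orbT.
  have mpi : pi < m by rewrite lt_min lt_pi /=; lra.
  have : lo <= psi <= hi by apply: inA; [|apply: c0]; rewrite /psi; lra.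
  rewrite /psi; lra.
(* The mirror case, except that 2 pi is not an admissible angle, so [psi] is taken slightly below
   it. *)
- have [th2|th2] := ltP th (pi / 2).
    pose psi := 2 * pi - (pi / 2 - th) / 2.
    have : lo <= psi <= hi.
      apply: inA; first by rewrite /psi; lra.
      have -> : psi - th = 2 * pi - ((pi / 2 - th) / 2 + th) by rewrite /psi; ring.
      by rewrite cos_2piB; apply: c0; lra.
    rewrite /psi; lra.
  pose m := Num.max hi th.
  pose psi := (m + (th + pi / 2)) / 2.
  have mlo : hi <= m by rewrite le_max lexx.
  have mth : th <= m by rewrite le_max lexx orbT.
  have mpi : m < pi by rewrite gt_max lt_pi /=; lra.
  have : lo <= psi <= hi by apply: inA; [|apply: c0]; rewrite /psi; lra.
  rewrite /psi; lra.
Qed.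

(** Unlike in [angles], the poles count and [psi] may be any real number. *)
Definition meets psi : Prop := exists2 s, 0 <= s <= pi & cos r <= lat_cos psi s.

Lemma angles_meets psi : A psi -> meets psi.
Proof.
move=> [x [xc _ _ xp]]; have [sb xE hx] := disk_meridian c_sphere xc xp.
by exists (sdist x (pole F)) => //; rewrite -dot_meridian_center -xE.
Qed.

(** The hypothesis says that the disk contains a pole, and all half-meridians end there. *)
Lemma meets_near psi : cos r <= `|cos b| -> meets psi.
Proof.
have pi0 := pi_gt0 R.
case: (leP 0 (cos b)) => cb; [rewrite ger0_norm // | rewrite ltr0_norm //] => h.
  by exists 0; [lra|rewrite /lat_cos sin0 cos0 mulr0 mul0r addr0 mulr1].
exists pi; first by lra.
by rewrite /lat_cos sinpi cospi mulr0 mul0r addr0 mulrN1.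
Qed.

(** Without an acute angle, [lat_cos psi s] is at most [cos b * cos s], hence at most [|cos b|]. *)
Lemma meets_visible psi : `|cos b| < cos r -> meets psi -> 0 < cos (psi - th).
Proof.
move=> far [s sb hs]; rewrite ltNge; apply/negP => cp.
have ss : 0 <= sin s by exact: sin_ge0_pi.
have : cos b * cos s <= `|cos b|.
  apply: (le_trans (ler_norm _)); rewrite normrM ler_piMr //; exact: cos_max.
have := mulr_ge0 sinb_ge0 ss; move: hs; rewrite /lat_cos; nra.
Qed.

Lemma sinb_gt0 : `|cos b| < cos r -> 0 < sin b.
Proof.
move=> far; rewrite lt_neqAle sinb_ge0 andbT; apply/eqP => /esym/sin0cos1 e.
by move: far; rewrite e ltNge cos_le1.
Qed.

(** The maximum [M] on the half-meridian satisfies [M ^+ 2 = cos b ^+ 2 + (sin b * cos (psi - th))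
    ^+ 2]. Solving [cos r <= M] for [cos (psi - th)] gives the threshold [Num.sqrt q], so the angles
    met form an arc around [th]. *)
Lemma meets_cos : `|cos b| < cos r -> exists2 k, 0 < k <= 1 &
  forall psi, meets psi <-> k <= cos (psi - th).
Proof.
have rB := r_bounds; have bB := b_bounds; have thB := th_bounds.
move=> far; have sb := sinb_gt0 far.
have cr0 : 0 < cos r by exact: le_lt_trans far.
have cb2 : cos b ^+ 2 < cos r ^+ 2.
  by rewrite -(real_normK (num_real (cos b))) ltr_sqr ?nnegrE // (ltW cr0).
have sr := sin2cos2 b.
pose q := (cos r ^+ 2 - cos b ^+ 2) / sin b ^+ 2.
have s2 : 0 < sin b ^+ 2 by exact: exprn_gt0.
have q0 : 0 < q by rewrite divr_gt0 // subr_gt0.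
have q1 : q <= 1.
  rewrite ler_pdivrMr // mul1r sr lerD2r -[1](expr1n _ 2).
  by rewrite ler_sqr ?nnegrE ?ler01 ?cos_le1 // (ltW cr0).
have form psi M : 0 < M -> M ^+ 2 = cos b ^+ 2 + (sin b * cos (psi - th)) ^+ 2 ->
    0 < cos (psi - th) -> (cos r <= M) = (Num.sqrt q <= cos (psi - th)).
  move=> M0 M2 cp.
  rewrite -[LHS]ler_sqr ?nnegrE ?(ltW M0) ?(ltW cr0) //.
  rewrite -[RHS]ler_sqr ?nnegrE ?(ltW cp) ?sqrtr_ge0 //.
  by rewrite sqr_sqrtr ?(ltW q0) // ler_pdivrMr // M2 exprMn lerBlDl mulrC.
exists (Num.sqrt q).
  by rewrite sqrtr_gt0 q0 /= -[leRHS]sqrtr1 ler_sqrt.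
move=> psi; split=> [mt|h].
  have cp := meets_visible far mt.
  have [M [s0 [M0 s0b e1 e2 M2]]] := lat_cos_form sb cp.
  rewrite -(form _ M) //; have [s _ hs] := mt; apply: le_trans hs _.
  by rewrite (lat_cosE _ e1 e2) ler_piMr ?cos_le1 // (ltW M0).
have cp : 0 < cos (psi - th) by apply: lt_le_trans h; rewrite sqrtr_gt0.
have [M [s0 [M0 s0b e1 e2 M2]]] := lat_cos_form sb cp.
exists s0; first by lra.
by rewrite (lat_cosE _ e1 e2) subrr cos0 mulr1 (form psi M).
Qed.

(* If the disk avoids the polar axis its angles form a genuine interval, so the
   half-meridian of any angle between the infimum and the supremum is met. *)
Lemma interval_meets phi :
  inf_angle F (sdisk r c) <= phi <= sup_angle F (sdisk r c) ->
  meets phi \/ meets 0.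
Proof.
have rB := r_bounds; have bB := b_bounds; have thB := th_bounds.
move=> phib; have pi0 := pi_gt0 R.
have [near|far] := leP (cos r) `|cos b|; first by left; exact: meets_near.
have [k /andP[k0 k1] kP] := meets_cos far.
have [|k_gt] := leP k (cos (0 - th)); first by move/kP; right.
left; apply/kP.
have kb : -1 <= k <= 1 by lra.
have d0 := acos_ge0 kb; have dpi := acos_lepi kb; have dK := acosK kb.
set d := acos k in d0 dpi dK.
have cos_far x : `|x| <= d -> k <= cos x by rewrite -dK => h; exact: norm_cos_ge.
(* As the half-meridian at 0 is missed, the arc of half-width [d] around [th] lies strictly between
   0 and 2 pi. *)
have th1 : d < th.
  rewrite ltNge; apply/negP => h; move: k_gt; rewrite ltNge cos_far //.
  by rewrite sub0r normrN ger0_norm; lra.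
have th2 : th < 2 * pi - d.
  rewrite ltNge; apply/negP => h; move: k_gt; rewrite ltNge sub0r cosN -cos_2piB.
  by rewrite cos_far // ger0_norm; lra.
have inA psi : A psi -> th - d <= psi <= th + d.
  move=> Ap; have /andP[p0 p2] := angles_range Ap.
  have /kP := angles_meets Ap; rewrite -dK => h.
  (* The wrapping alternative contradicts [th1] or [th2]. *)
  have := cos_ge_cases _ _ h; case.
  - by rewrite d0.
  - by rewrite ler_norml; lra.
  - by rewrite ler_norml; lra.
  - by rewrite ler_normr => /orP[]; lra.
have lo : th - d <= inf_angle F (sdisk r c).
  by apply: lb_le_inf => [|y /inA/andP[]//]; exists th; exact: angles_center.
have hi : sup_angle F (sdisk r c) <= th + d.
  by apply: ge_sup => [|y /inA/andP[]//]; exists th; exact: angles_center.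
by apply: cos_far; rewrite ler_norml; lra.
Qed.

End Center.
End Disk.

(** * Covering the centers of a layer near a half-meridian *)

Section Cover.
Context {R : realType} (F : polar_frame R) (r : R).
Hypothesis r_bounds : (0 < r < pi)%R.
Local Open Scope ring_scope.

(** The unit normal of the plane of the half-meridian at [psi]. *)
Definition normal (psi : R) : 'rV[R]_3 := point F 0 (- sin psi) (cos psi).

(** For [e = 1] or [e = -1], the point at distance [r / 2] on one side of the great circle of the
    half-meridian, with foot at [s]. *)
Definition side_point (psi s e : R) : 'rV[R]_3 :=
  cos (r / 2) *: meridian F psi s + (e * sin (r / 2)) *: normal psi.

(** Feet of centers with latitudes in [S, S + 2r] lie in [S - r, S + 3r], which splits into four
    intervals of length [r] with these midpoints. *)
Definition cover_points (psi S : R) : seq 'rV[R]_3 :=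
  [:: pole F; - pole F] ++
  [seq side_point psi (S - r / 2 + k%:R * r) e | k <- iota 0 4, e <- [:: 1; -1]].

Lemma side_point_sphere psi s e : e ^+ 2 = 1 -> sphere (side_point psi s e).
Proof.
move=> e2; have mm := meridian_sphere F psi s; rewrite /sphere /= in mm.
have nn : dot (normal psi) (normal psi) = 1.
  by rewrite dot_point -(cos2Dsin2 psi); ring.
have mn : dot (meridian F psi s) (normal psi) = 0 by rewrite dot_point; ring.
rewrite /sphere /= /side_point; move: (meridian F psi s) (normal psi) mm nn mn.
move=> m n mm nn mn; rewrite !(dotDl, dotDr, dotZl, dotZr) (dotC n) mm nn mn.
have := cos2Dsin2 (r / 2); move: (cos _) (sin _) => C T CT.
transitivity (C ^+ 2 + e ^+ 2 * T ^+ 2); [ring | by rewrite e2 mul1r].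
Qed.

(* Writing the center as cos rho m + sin rho n with m on the meridian and
   |rho| <= r, the point (cos (r/2)) m' + sin (r/2) n on the same side covers it
   when m' is within r/2 of m. *)
Lemma half_disk_bound M N h : 0 <= N -> cos r <= M -> 0 <= M -> M ^+ 2 + N ^+ 2 = 1 ->
    cos (r / 2) <= h ->
  cos r <= cos (r / 2) * (M * h) + sin (r / 2) * N.
Proof.
have rB := r_bounds.
move=> N0 rM M0 MN hh.
have Mb : -1 <= M <= 1 by apply/andP; split; nra.
have a0 := acos_ge0 Mb; have api := acos_lepi Mb; have aK := acosK Mb.
have sa : sin (acos M) = N.
  by rewrite sin_acos // -MN addrC addKr sqrtr_sqr ger0_norm.
have ar : acos M <= r.
  have := @cos_ge_norm _ (acos M) r; rewrite aK ger0_norm //; apply=> //; lra.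
(* As [acos M] lies between 0 and [r], it is within [r / 2] of [r / 2]. *)
have : cos (r / 2) <= cos (acos M - r / 2).
  by apply: norm_cos_ge; [rewrite ler_norml; lra|lra].
rewrite cosB aK sa => h1.
have c0 : 0 <= cos (r / 2) by apply: cos_ge0_pihalf; lra.
have s0 : 0 <= sin (r / 2) by apply: sin_ge0_pi; lra.
have c1 := cos_le1 (r / 2).
have -> : cos r = cos (r / 2) * cos (r / 2) - sin (r / 2) * sin (r / 2).
  by rewrite -cosD; congr cos; lra.
move: (cos (r / 2)) (sin (r / 2)) hh h1 c0 s0 c1 => C T hh h1 c0 s0 c1.
have : C * (M * C) <= C * (M * h) by apply: ler_wpM2l => //; apply: ler_wpM2l.
have : C * C <= C * (M * C + N * T) by apply: ler_wpM2l.
have := mulr_ge0 s0 N0.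
have : C * (T * N) <= 1 * (T * N) by apply: ler_wpM2r => //; exact: mulr_ge0.
have : 0 <= T * T by apply: mulr_ge0.
nra.
Qed.

Lemma cover_pointsP c b th psi S : sphere c -> polar_coord F c b th ->
  S <= b <= S + (r + r) -> meets r b th psi ->
  exists2 q, q \in cover_points psi S & sdisk r c q.
Proof.
have rB := r_bounds.
have rb : 0 <= r <= pi by lra.
move=> c1 cp Sb mt; have [bB thB cE] := polar_coordP cp c1.
have dpc : dot (pole F) c = cos b.
  by rewrite [pole F](pole_point F) {1}cE dot_point; ring.
have pole1 : sphere (pole F) by have [] := polar_frame_unit F.
have npole1 : sphere (- pole F).
  by move: pole1; rewrite /sphere /= dotNr dotNl opprK.
have [near|far] := leP (cos r) `|cos b|.
  move: near; case: (leP 0 (cos b)) => cb; [rewrite ger0_norm // | rewrite ltr0_norm //] => h.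
    exists (pole F); first by rewrite mem_head.
    by split=> //; rewrite sdist_le // dpc.
  exists (- pole F); first by rewrite inE mem_head orbT.
  by split=> //; rewrite sdist_le // dotNl dpc.
have vis := meets_visible c1 cp far mt.
have sb := sinb_gt0 c1 cp far.
have [M [s0 [M0 s0b e1 e2 M2]]] := lat_cos_form sb vis.
have rM : cos r <= M.
  have [s _] := mt; rewrite (lat_cosE _ e1 e2) => h; apply: le_trans h _.
  by rewrite ler_piMr ?cos_le1 // (ltW M0).
(* The foot [s0] of the center on the meridian is at distance at most [r] from it, so the two
   latitudes differ by at most [r]. *)
have near_b : `|s0 - b| <= r.
  apply: cos_ge_norm; [lra|by rewrite ler_norml; lra|].
  apply: (le_trans rM); rewrite cosB.
  have ss : 0 <= sin s0 by apply: sin_ge0_pi; lra.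
  have cl := cos_le1 (psi - th).
  have -> : M = cos s0 * cos b + sin s0 * (sin b * cos (psi - th)).
    rewrite e1 e2 -[LHS]mulr1 -(cos2Dsin2 s0); ring.
  rewrite lerD2l ler_wpM2l // ler_piMr //; exact: ltW.
rewrite ler_norml in near_b.
have [k k4 near_k] : exists2 k, (k < 4)%N & `|S - r / 2 + k%:R * r - s0| <= r / 2.
  have [|] := leP s0 S; first by exists 0%N => //; rewrite ler_norml; lra.
  have [|] := leP s0 (S + r); first by exists 1%N => //; rewrite ler_norml; lra.
  have [|] := leP s0 (S + r + r); first by exists 2%N => //; rewrite ler_norml; lra.
  by exists 3%N => //; rewrite ler_norml; lra.
set x := _ + _ * r in near_k.
(* The component of the center along [normal psi]; its sign [e] selects the side. *)
set w := sin b * sin (th - psi).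
pose e : R := if 0 <= w then 1 else -1.
have ee : e ^+ 2 = 1 by rewrite /e; case: ifP; rewrite ?sqrrN expr1n.
have ew : e * w = `|w|.
  rewrite /e; case: ifP => [w0|/negbT]; first by rewrite mul1r ger0_norm.
  by rewrite -ltNge => w0; rewrite mulN1r ltr0_norm.
exists (side_point psi x e).
  rewrite mem_cat; apply/orP; right; apply/allpairsP; exists (k, e).
  split; [by rewrite mem_iota | | by []].
  by rewrite /e /=; case: ifP; rewrite !inE eqxx ?orbT.
have q1 := side_point_sphere psi x ee.
split=> //; rewrite sdist_le //.
have -> : dot (side_point psi x e) c =
    cos (r / 2) * (M * cos (x - s0)) + sin (r / 2) * (e * w).
  have nc : dot (normal psi) c = w by rewrite {1}cE dot_point /w sinB; ring.
  rewrite /side_point -(lat_cosE x e1 e2) -(dot_meridian_center c1 cp) -nc.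
  by move: (meridian _ _ _) (normal _) => m n; rewrite dotDl !dotZl; ring.
rewrite ew; apply: half_disk_bound => //; first exact: ltW.
- rewrite real_normK ?num_real // /w -opprB sinN mulrN sqrrN !exprMn M2 exprMn -addrA.
  by rewrite -mulrDr cos2Dsin2 mulr1 cos2Dsin2.
- by apply: norm_cos_ge => //; lra.
Qed.

End Cover.

(** * Disk graphs *)

Section DiskGraph.
Context {R : realType} (F : polar_frame R) (r : R).
Hypothesis r_bounds : (0 < r < pi)%R.
Local Open Scope ring_scope.

(** Off the poles, the angle of the common point lies in both intervals. A pole has no angle, but
    then both intervals contain pi. *)
Lemma angles_overlap c1 c2 b1 b2 th1 th2 x : sphere c1 -> sphere c2 ->
    polar_coord F c1 b1 th1 -> polar_coord F c2 b2 th2 ->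
    sdisk r c1 x -> sdisk r c2 x ->
  inf_angle F (sdisk r c1) <= sup_angle F (sdisk r c2).
Proof.
move=> c1S c2S cp1 cp2 x1 x2.
have rb : 0 <= r <= pi by case/andP: r_bounds => /ltW -> /ltW ->.
have at_pole c b th : sphere c -> polar_coord F c b th -> sdisk r c x ->
    (x == pole F) || (x == - pole F) ->
    inf_angle F (sdisk r c) <= pi <= sup_angle F (sdisk r c).
  move=> cS cp [xS xr] xp; apply: (pole_disk_angles r_bounds cS cp).
  move: xr; rewrite sdist_le // => h; apply: le_trans h _.
  have dpc : dot (pole F) c = cos b.
    by rewrite [pole F](pole_point F) {1}(polar_point cp) dot_point; ring.
  case/orP: xp => /eqP ->; rewrite ?dotNl dpc; first exact: ler_norm.
  by rewrite -[leRHS]normrN ler_norm.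
have [xp|] := boolP ((x == pole F) || (x == - pole F)).
  have /andP[+ _] := at_pole _ _ _ c1S cp1 x1 xp.
  have /andP[_] := at_pole _ _ _ c2S cp2 x2 xp.
  by move=> h1 h2; exact: le_trans h2 h1.
rewrite negb_or => /andP[xn1 xn2].
have [psi xpsi] := polar_coord_exists F (proj1 x1).
have in_angles c : sdisk r c x -> angles F (sdisk r c) psi by exists x.
have /andP[h1 _] := angles_inf_sup (in_angles _ x1).
have /andP[_ h2] := angles_inf_sup (in_angles _ x2).
exact: le_trans h1 h2.
Qed.

Lemma latitude_overlap c1 c2 b1 b2 th1 th2 x : sphere c1 -> sphere c2 ->
    polar_coord F c1 b1 th1 -> polar_coord F c2 b2 th2 ->
    sdisk r c1 x -> sdisk r c2 x -> b2 <= b1 + (r + r).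
Proof.
move=> c1S c2S cp1 cp2 x1 x2.
have := latitude_disk r_bounds c1S cp1 x1.
have := latitude_disk r_bounds c2S cp2 x2.
rewrite !ler_norml; lra.
Qed.

End DiskGraph.

(** Pigeonhole: a choice of covering elements is injective on an independent set. *)
Lemma independent_size (V : finType) (e : rel V) (I : {set V})
    (Q : eqType) (covers : Q -> V -> Prop) (s : seq Q) :
  independent e I ->
  (forall v, v \in I -> exists2 q, q \in s & covers q v) ->
  (forall q u v, covers q u -> covers q v -> u != v -> e u v) ->
  (#|I| <= size s)%N.
Proof.
move=> indI covI adj.
(* A nonempty [I] supplies the default value [q0] for vertices outside it. *)
case: (posnP #|I|) => [->//|/card_gt0P[v0 /covI[q0 _ _]]].
have /choice[f fP] : forall v, exists q, v \in I -> q \in s /\ covers q v.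
  move=> v; case: (boolP (v \in I)) => [/covI[q qs qv]|_]; last by exists q0.
  by exists q.
have f_inj : {in enum I &, injective f}.
  move=> u v; rewrite !mem_enum => uI vI fuv.
  apply/eqP/negPn/negP => uv.
  have [_ cu] := fP u uI; have [_ cv] := fP v vI; rewrite -fuv in cv.
  move/forall_inP: indI => /(_ u uI)/forall_inP/(_ v vI)/negP.
  by apply; exact: adj cu cv uv.
rewrite cardE -(size_map f); apply: uniq_leq_size.
  by rewrite map_inj_in_uniq ?enum_uniq.
by move=> q /mapP[v]; rewrite mem_enum => /fP[qs _] ->.
Qed.

Lemma layered_number_le (V : finType) (e : rel V) l :
  has_layered_witness e l -> (layered_tree_independence_number e <= l)%N.
Proof.
move=> h; rewrite /layered_tree_independence_number; case: ex_minnP => m _.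
by apply; apply/asboolP.
Qed.

Lemma extend_ord (R : realType) n (f : 'I_n -> R) (i : 'I_n) : extend f i = f i.
Proof. by rewrite /extend valK. Qed.

(** The non-algorithmic half of the theorem comes without coordinates, so a frame has to be
    supplied. *)
Lemma standard_frame (R : realType) : polar_frame R.
Proof.
have dot_delta (i j : 'I_3) :
    (dot (delta_mx 0 i) (delta_mx 0 j) = (i == j)%:R :> R)%R.
  rewrite /dot (bigD1 i) //= big1 => [|k ki].
    by rewrite !mxE !eqxx mul1r addr0.
  by rewrite !mxE (negbTE ki) mul0r.
exists (delta_mx 0 0)%R (delta_mx 0 1)%R (delta_mx 0 2%:R)%R.
  by split; rewrite /sphere /= dot_delta eqxx.
by split; rewrite dot_delta.
Qed.

Theorem theorem3p15 (R : realType) :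
  (exists (prog : cmd) (C : nat),
    forall (n : nat) (r : R) (c : 'I_n -> 'rV[R]_3)
           (F : polar_frame R) (b theta : 'I_n -> R),
      (0 < n)%N -> (0 < r < pi)%R ->
      (forall i, sphere (c i)) ->
      (forall i, polar_coord F (c i) (b i) (theta i)) ->
      exists (t : nat) (s : store R),
        [/\ exec (extend (fun i => inf_angle F (sdisk r (c i))))
                 (extend (fun i => sup_angle F (sdisk r (c i))))
                 prog (input r b theta) t s,
            (t <= C * maxn 1 (n * up_log 2 n))%N,
            out_wf s
          & [/\ tree_decomposition (sdisk_graph r c) (@out_tree R s)
                                   (@out_bag R s n),
                (#|'I_(out_size s)| <= 2 * n)%N,
                layering (sdisk_graph r c) (@out_layer R s n)
              & witness (sdisk_graph r c) (@out_bag R s n)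
                        (@out_layer R s n) 30]])
  /\
  (forall (n : nat) (r : R) (c : 'I_n -> 'rV[R]_3),
      (0 < r < pi)%R ->
      (forall i, sphere (c i)) ->
      (layered_tree_independence_number (sdisk_graph r c) <= 30)%N).
Proof.
(* The algorithmic half is kept as a local fact because the second half follows from it. *)
match goal with |- ?A /\ _ => have algo : A end.
  exists main_prog, 200 => n r c F b theta n0 rB cS cP.
  have r0 : (0 <= r)%R by case/andP: rB => /ltW.
  have adj_disk u v : sdisk_graph r c u v ->
      exists x, sdisk r (c u) x /\ sdisk r (c v) x.
    by case/andP=> _ /asboolP[x [xu xv]]; exists x.
  have sym u v : sdisk_graph r c u v -> sdisk_graph r c v u.
    case/andP=> uv /asboolP[x [xu xv]]; rewrite /sdisk_graph eq_sym uv /=.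
    by apply/asboolP; exists x.
  have adj_b u v : sdisk_graph r c u v -> (b v <= b u + (r + r))%R.
    move/adj_disk=> [x [xu xv]].
    exact: (latitude_overlap rB (cS u) (cS v) (cP u) (cP v) xu xv).
  pose io := extend (fun i => inf_angle F (sdisk r (c i))).
  pose so := extend (fun i => sup_angle F (sdisk r (c i))).
  have [t [s [ex le_t [lay [key [l [keyP pl sl out]]]]]]] :=
    @main_progP R io so n r b theta n0 r0.
  have key_lo (v : 'I_n) : key v = inf_angle F (sdisk r (c v)).
    by have [-> _] := keyP v (ltn_ord v); exact: extend_ord.
  have key_hi (v : 'I_n) : key (v + n)%N = sup_angle F (sdisk r (c v)).
    by have [_ ->] := keyP v (ltn_ord v); exact: extend_ord.
  have lo_hi v := inf_le_sup_angle rB (cS v) (cP v).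
  have layP (u v : 'I_n) := lay u v (ltn_ord u) (ltn_ord v).
  exists t, s; split=> //; first exact: out_wf_events out.
  split.
  - apply: (out_tree_decomposition n0 key_lo key_hi lo_hi pl sl out) => u v.
    move/adj_disk=> [x [xu xv]]; split.
      exact: (angles_overlap rB (cS u) (cS v) (cP u) (cP v) xu xv).
    exact: (angles_overlap rB (cS v) (cS u) (cP v) (cP u) xv xu).
  - by have [sz _ _ _] := out; rewrite card_ord /out_size sz; lia.
  - move=> u v uv; rewrite /out_layer; split.
      have [h _] := layP v u; apply: h; rewrite !extend_ord.
      by apply: adj_b; exact: sym.
    by have [h _] := layP u v; apply: h; rewrite !extend_ord; exact: adj_b.
  - move=> a i; apply/bigmax_leqP => I /andP[/fintype.subsetP subI indI].
    case: (posnP #|I|) => [->//|/card_gt0P[v0 v0I]].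
    (* All latitudes in [I] lie within [2r] above their minimum, as [I] is inside one layer. *)
    pose S := b [arg min_(v < v0 in I) b v]%O.
    have Smin v : v \in I -> (S <= b v <= S + (r + r))%R.
      move=> vI; rewrite /S; case: arg_minP => // w wI wmin.
      rewrite wmin //=; have [_] := layP w v; rewrite !extend_ord; apply.
      have := subI _ wI; have := subI _ vI; rewrite !finset.inE /out_layer.
      by move=> /andP[_ /eqP ->] /andP[_ /eqP ->].
    pose phi := key (nth 0%N l a).
    pose Q := cover_points F r phi S ++ cover_points F r 0%R S.
    (* Ten points for each of the two half-meridians: 20 in all. *)
    apply: (@leq_trans (size Q)); last by rewrite /Q size_cat.
    apply: (independent_size (covers := fun q v => sdisk r (c v) q) indI).
      move=> v vI; have := subI _ vI; rewrite finset.in_setI => /andP[va _].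
      have := out_bag_key n0 key_lo key_hi lo_hi pl sl out va.
      move/(interval_meets rB (cS v) (cP v)) => [] mt.
        have [q qQ qv] := cover_pointsP rB (cS v) (cP v) (Smin v vI) mt.
        by exists q; rewrite // mem_cat qQ.
      have [q qQ qv] := cover_pointsP rB (cS v) (cP v) (Smin v vI) mt.
      by exists q; rewrite // mem_cat qQ orbT.
    move=> q u v qu qv uv; rewrite /sdisk_graph uv /=.
    by apply/asboolP; exists q.
split=> // n r c rB cS; apply: layered_number_le.
(* The algorithm is stated for [0 < n]; without vertices any decomposition will do, since all
   independent sets are empty. *)
have [n0|n0] := posnP n.
  have [l /asboolP[T [t [X [L [td ly _]]]]]] := has_layered_witness_ex (sdisk_graph r c).
  exists T, t, X, L; split=> // a i; apply/bigmax_leqP => I _.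
  by rewrite (leq_trans (max_card _)) // card_ord n0.
have [prog [C algo']] := algo.
have /choice[theta thP] : forall i, exists th,
    polar_coord (standard_frame R) (c i) (sdist (c i) (pole (standard_frame R))) th.
  by move=> i; exact: polar_coord_exists.
have [t [s [_ _ _ [td _ ly w]]]] := algo' n r c _ _ _ n0 rB cS thP.
by exists _, (@out_tree R s), (@out_bag R s n), (@out_layer R s n).
Qed.
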